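(* Let $\ell\ge 2$ be an integer. For $n$ sufficiently large (depending on $\ell$), $N_\ell(n)$ is log-concave, i.e. $N_\ell(n)^2\ge N_\ell(n+1)N_\ell(n-1)$ for all sufficiently large $n$.
   Context: For positive integers $\ell,n$, let $S_n$ be the symmetric group on $n$ letters, let $C_{\ell,n} := \{(\pi_1,\dots,\pi_\ell)\in S_n^\ell : \pi_j\pi_k=\pi_k\pi_j \text{ for } 1\le j,k\le \ell\}$, and let $N_\ell(n) := |C_{\ell,n}|/|S_n|$. *)

(* Defs.v *)
From mathcomp Require Import all_boot all_order all_fingroup all_algebra.

Set Implicit Arguments.
Unset Strict Implicit.
Unset Printing Implicit Defensive.

Import Order.TTheory GRing.Theory Num.Theory.

Definition commuting_tuples (l n : nat) : {set {ffun 'I_l -> 'S_n}} :=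
  [set p : {ffun 'I_l -> 'S_n} |
    [forall j, forall k, (p j * p k == p k * p j)%g]].

Definition commuting_ratio (l n : nat) : rat :=
  (#|commuting_tuples l n|%:R / #|{: 'S_n}|%:R)%R.

(* Main.v *)
From Stdlib Require Import ZArith Reals Lra Lia Psatz.
From Coquelicot Require Import Coquelicot.
Require Import Defs.
From mathcomp Require Import all_boot all_order all_fingroup all_algebra all_solvable.
From mathcomp Require Import zify.

(** Write [N n] for the number of commuting [l]-tuples in [S_n] divided by [n!].

    The exponential formula.  A commuting tuple on [n] points splits along the
    orbits of the group it generates.  Marking a point and splitting off its
    orbit gives
      [n N(n) = \sum_k s(k) N(n - k)],
    where [s(k) = k t(k) / k!] and [t(k)] counts the transitive commuting tuples
    on [k] points ([comm_tuples_rec], [comm_weight_rec]).  A transitive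
    commuting tuple generates a regular abelian group of rank at most [l]; there
    are polynomially many isomorphism types of those, and isomorphic regular
    groups are conjugate.  With an explicit supply of transitive tuples coming
    from [k]-cycles and their powers this gives [k <= s(k) <= B k^A]
    ([trans_weight_lower], [trans_weight_upper]).

    These two bounds already force log-concavity for large [n], with no
    asymptotic expansion of [N] ([eventually_log_concave]).  By the inequality
    between the arithmetic and the geometric mean it is enough to find one
    radius [r > 0] with [r N(n+1) + N(n-1) / r <= 2 N(n)].  Up to a positive
    factor, [N(j) r^j] is the integral over [[0, pi]] of the real part of
      [exp (\sum_(k <= n+1) (s(k) r^k / k) e^(i k t)) e^(- i j t)]
    ([fourier_coef]), so the required inequality says that the integral for
    [j = n], taken against the weight [2 (1 - cos t)], is positive
    ([fourier_second_difference]).  The weight is nonnegative, so only the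
    oscillation of the exponential can hurt, and a crude saddle-point argument
    suffices ([saddle_point_positive]).  Choose [r] so that
    [\sum_k s(k) r^k = n] ([exists_saddle_radius]); then the phase is stationary
    at [t = 0].  Let [V = \sum_k k s(k) r^k].  On a window slightly wider than
    [1 / sqrt V] the phase stays below [1], so the integrand is nonnegative, and
    the part [t <= 1 / sqrt V] contributes at least a constant times
    [V^(-3/2)].  Outside the window the integrand is exponentially small while
    [V] is only polynomially large in [1 / (1 - r)].  That decay comes from the
    quadratic behaviour of [1 - cos (k t)] for small [t] ([one_sub_cos_ge]), and
    from comparison with a geometric series, thanks to [s(k) >= k], for the
    other [t] ([geom_cos_gap_ge]). *)

Local Close Scope R_scope.

(** * Trigonometric sums and their Fourier coefficients *)

Section Analysis.
Local Open Scope R_scope.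

Lemma is_derive_sum (f : nat -> R -> R) (df : nat -> R) (M : nat) (t : R) :
  (forall k, is_derive (f k) t (df k)) ->
  is_derive (fun u => sum_f_R0 (fun k => f k u) M) t (sum_f_R0 df M).
Proof.
move=> Hf; elim: M => [|M IH] //=.
exact: (is_derive_plus (fun u => sum_f_R0 (fun k => f k u) M) (f M.+1)).
Qed.

(** Real part of the logarithm of the generating function on a circle:
    with [b k = s k * r ^ k] this is [Re (\sum_k (s k / k) z^k)] at
    [z = r e^(i t)], and [sin_sum] is the imaginary part.  At [k = 0] the
    coefficient vanishes, as [b 0 = 0] throughout. *)
Definition cos_sum (b : nat -> R) (M : nat) (t : R) : R :=
  sum_f_R0 (fun k => b k / INR k * cos (INR k * t)) M.

Definition sin_sum (b : nat -> R) (M : nat) (t : R) : R :=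
  sum_f_R0 (fun k => b k / INR k * sin (INR k * t)) M.

(** [Re (exp (\sum_k (b k / k) e^(i k t)) e^(- i j t))].  It is even in [t], so
    half of the circle carries all its Fourier coefficients. *)
Definition wave (b : nat -> R) (M : nat) (j : Z) (t : R) : R :=
  exp (cos_sum b M t) * cos (sin_sum b M t - IZR j * t).

Definition fourier (b : nat -> R) (M : nat) (j : Z) : R :=
  RInt (wave b M j) 0 PI.

Lemma INR_div_mul (b : nat -> R) (k : nat) :
  b 0%nat = 0 -> b k / INR k * INR k = b k.
Proof.
move=> b0; case: k => [|k]; first by rewrite b0 /= ; lra.
field; exact: not_0_INR.
Qed.

Lemma is_derive_cos_sum (b : nat -> R) (M : nat) (t : R) : b 0%nat = 0 ->
  is_derive (cos_sum b M) t (- sum_f_R0 (fun k => b k * sin (INR k * t)) M).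
Proof.
move=> b0.
have -> : - sum_f_R0 (fun k => b k * sin (INR k * t)) M
        = sum_f_R0 (fun k => - (b k * sin (INR k * t))) M.
  elim: M => [|M /= <-] //=; lra.
apply: is_derive_sum => k; auto_derive => //.
rewrite -{2}(INR_div_mul b k b0); ring.
Qed.

Lemma is_derive_sin_sum (b : nat -> R) (M : nat) (t : R) : b 0%nat = 0 ->
  is_derive (sin_sum b M) t (sum_f_R0 (fun k => b k * cos (INR k * t)) M).
Proof.
move=> b0.
apply: is_derive_sum => k; auto_derive => //.
rewrite -{2}(INR_div_mul b k b0); ring.
Qed.

Lemma continuous_wave (b : nat -> R) (M : nat) (j : Z) (t : R) : b 0%nat = 0 ->
  continuous (wave b M j) t.
Proof.
move=> b0; apply: ex_derive_continuous; rewrite /wave; auto_derive.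
by split; [exists (- sum_f_R0 (fun k => b k * sin (INR k * t)) M); exact: is_derive_cos_sum
  | split=> //; exists (sum_f_R0 (fun k => b k * cos (INR k * t)) M); exact: is_derive_sin_sum].
Qed.

Lemma ex_RInt_continuous_all (f : R -> R) (u v : R) :
  (forall t, continuous f t) -> ex_RInt f u v.
Proof. by move=> Hf; apply: (ex_RInt_continuous (V := R_CompleteNormedModule)). Qed.

Lemma ex_RInt_wave (b : nat -> R) (M : nat) (j : Z) (u v : R) : b 0%nat = 0 ->
  ex_RInt (wave b M j) u v.
Proof. by move=> b0; apply: ex_RInt_continuous_all => t; exact: continuous_wave. Qed.

(** The addition formula for [cos], summed: it turns the derivatives of
    [cos_sum] and [sin_sum] into shifts of the frequency [j]. *)
Lemma wave_shift_sum (b : nat -> R) (M m : nat) (j : Z) (t : R) :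
  sum_f_R0 (fun k => b k * wave b M (j - Z.of_nat k) t) m
  = exp (cos_sum b M t) *
     (cos (sin_sum b M t - IZR j * t) * sum_f_R0 (fun k => b k * cos (INR k * t)) m
      - sin (sin_sum b M t - IZR j * t) * sum_f_R0 (fun k => b k * sin (INR k * t)) m).
Proof.
have shift k : b k * wave b M (j - Z.of_nat k) t = exp (cos_sum b M t) *
   (cos (sin_sum b M t - IZR j * t) * (b k * cos (INR k * t))
    - sin (sin_sum b M t - IZR j * t) * (b k * sin (INR k * t))).
  rewrite /wave.
  have -> : sin_sum b M t - IZR (j - Z.of_nat k) * t
          = (sin_sum b M t - IZR j * t) + INR k * t.
    rewrite minus_IZR -INR_IZR_INZ; ring.
  rewrite cos_plus; ring.
elim: m => [|m IH]; first by rewrite /= -(shift 0%nat).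
rewrite !tech5 IH shift; ring.
Qed.

(** The imaginary counterpart of [wave] is a primitive of the defect in the
    recurrence of [fourier_rec]. *)
Lemma is_derive_conjugate_wave (b : nat -> R) (M : nat) (j : Z) (t : R) : b 0%nat = 0 ->
  is_derive (fun u => exp (cos_sum b M u) * sin (sin_sum b M u - IZR j * u)) t
    (sum_f_R0 (fun k => b k * wave b M (j - Z.of_nat k) t) M - IZR j * wave b M j t).
Proof.
move=> b0; rewrite wave_shift_sum /wave.
have HP := is_derive_cos_sum b M t b0; have HQ := is_derive_sin_sum b M t b0.
auto_derive.
  by split; [eexists; exact: HP | split=> //; eexists; exact: HQ].
rewrite (is_derive_unique _ _ _ HP) (is_derive_unique _ _ _ HQ) /Rminus; ring.
Qed.

Lemma is_RInt_sum (f : nat -> R -> R) (M : nat) (u v : R) :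
  (forall k, ex_RInt (f k) u v) ->
  is_RInt (fun t => sum_f_R0 (fun k => f k t) M) u v (sum_f_R0 (fun k => RInt (f k) u v) M).
Proof.
move=> Hf; elim: M => [|M IH] /=; first exact: RInt_correct.
apply: (is_RInt_plus (fun t => sum_f_R0 (fun k => f k t) M) (f M.+1)) => //.
exact: RInt_correct.
Qed.

Lemma sin_sum_PI (b : nat -> R) (M : nat) : sin_sum b M PI = 0.
Proof.
rewrite /sin_sum; elim: M => [|M IH]; first by rewrite /= Rmult_0_l sin_0 Rmult_0_r.
rewrite tech5 IH (sin_eq_0_1 (INR M.+1 * PI)); first ring.
by exists (Z.of_nat M.+1); rewrite -INR_IZR_INZ.
Qed.

Lemma sin_sum_0 (b : nat -> R) (M : nat) : sin_sum b M 0 = 0.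
Proof.
by rewrite /sin_sum; elim: M => [|M IH]; rewrite ?tech5 ?IH /= !Rmult_0_r sin_0 !Rmult_0_r ?Rplus_0_l.
Qed.

(** Integration by parts: the boundary terms vanish because [sin] does at
    integer multiples of [PI].  This is [x G'(x) = (\sum_k b k x^k) G(x)] read
    off on coefficients, for [G] the exponential of [\sum_k (b k / k) x^k]. *)
Lemma fourier_rec (b : nat -> R) (M : nat) (j : Z) : b 0%nat = 0 ->
  IZR j * fourier b M j = sum_f_R0 (fun k => b k * fourier b M (j - Z.of_nat k)) M.
Proof.
move=> b0.
have I1 : is_RInt (fun t => sum_f_R0 (fun k => b k * wave b M (j - Z.of_nat k) t) M
                            - IZR j * wave b M j t) 0 PI 0.
  have E : minus ((fun u => exp (cos_sum b M u) * sin (sin_sum b M u - IZR j * u)) PI)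
             ((fun u => exp (cos_sum b M u) * sin (sin_sum b M u - IZR j * u)) 0) = 0.
    rewrite /Hierarchy.minus /Hierarchy.plus /Hierarchy.opp /= sin_sum_PI sin_sum_0.
    have -> : sin (0 - IZR j * PI) = 0.
      by apply: sin_eq_0_1; exists (Z.opp j); rewrite opp_IZR; ring.
    by rewrite !Rmult_0_r Rminus_0_r sin_0 Rmult_0_r Ropp_0 Rplus_0_r.
  rewrite -[X in is_RInt _ _ _ X]E.
  apply: (is_RInt_derive (fun u => exp (cos_sum b M u) * sin (sin_sum b M u - IZR j * u))) => t _.
    exact: is_derive_conjugate_wave.
  apply: (continuous_minus (V := R_NormedModule)).
    apply: ex_derive_continuous.
    suff H m : ex_derive (fun t0 => sum_f_R0 (fun k => b k * wave b M (j - Z.of_nat k) t0) m) t by [].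
    have Hw i : ex_derive (wave b M i) t.
      rewrite /wave; auto_derive.
      by split; [eexists; exact: is_derive_cos_sum | split=> //; eexists; exact: is_derive_sin_sum].
    elim: m => [|m IH] /=; first by apply: ex_derive_mult => //; exact: ex_derive_const.
    apply: (ex_derive_plus (V := R_NormedModule)) => //.
    by apply: ex_derive_mult => //; exact: ex_derive_const.
  apply: (continuous_mult (K := R_AbsRing)); first exact: continuous_const.
  exact: continuous_wave.
have I2 : is_RInt (fun t => sum_f_R0 (fun k => b k * wave b M (j - Z.of_nat k) t) M
                            - IZR j * wave b M j t) 0 PI
   (sum_f_R0 (fun k => b k * fourier b M (j - Z.of_nat k)) M - IZR j * fourier b M j).
  apply: (is_RInt_minus (V := R_NormedModule)).
    have -> : sum_f_R0 (fun k => b k * fourier b M (j - Z.of_nat k)) M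
      = sum_f_R0 (fun k => RInt (fun t => b k * wave b M (j - Z.of_nat k) t) 0 PI) M.
      apply: PartSum.sum_eq => k _; rewrite (RInt_scal (V := R_CompleteNormedModule)) //.
      exact: ex_RInt_wave.
    apply: is_RInt_sum => k.
    by apply: (ex_RInt_scal (V := R_NormedModule)); exact: ex_RInt_wave.
  by apply: (is_RInt_scal (V := R_NormedModule)); apply: RInt_correct; exact: ex_RInt_wave.
have := is_RInt_unique _ _ _ _ I1; rewrite (is_RInt_unique _ _ _ _ I2); lra.
Qed.

Lemma exp_le_compat (x y : R) : x <= y -> exp x <= exp y.
Proof. by case=> [/exp_increasing/Rlt_le | ->] //; exact: Rle_refl. Qed.

Lemma cos_sum_le (b : nat -> R) (M : nat) (t : R) :
  (forall k, 0 <= b k) -> cos_sum b M t <= cos_sum b M 0.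
Proof.
move=> b_ge0; apply: sum_Rle => k _; rewrite Rmult_0_r cos_0.
apply: Rmult_le_compat_l; last by case: (COS_bound (INR k * t)).
case: k => [|k]; first by rewrite /= /Rdiv Rinv_0 Rmult_0_r; lra.
by apply: Rdiv_le_0_compat => //; apply: lt_0_INR; lia.
Qed.

Lemma fourier_bounded (b : nat -> R) (M : nat) : b 0%nat = 0 -> (forall k, 0 <= b k) ->
  forall j, Rabs (fourier b M j) <= PI * exp (cos_sum b M 0).
Proof.
move=> b0 b_ge0 j; rewrite -[X in X * _](Rminus_0_r PI).
apply: abs_RInt_le_const; [by have := PI_RGT_0; lra | exact: ex_RInt_wave | move=> t _].
rewrite /wave Rabs_mult Rabs_pos_eq; last by apply: Rlt_le; exact: exp_pos.
rewrite -[X in _ <= X]Rmult_1_r; apply: Rmult_le_compat.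
- by apply: Rlt_le; exact: exp_pos.
- exact: Rabs_pos.
- by apply: exp_le_compat; exact: cos_sum_le.
- by apply/Rabs_le; exact: COS_bound.
Qed.

(** [G] is a power series, so it has no negative frequencies.  Here this follows
    from the recurrence alone: the coefficients are bounded, and far to the left
    each is at most half the supremum of those further left, hence zero; the
    recurrence then propagates the vanishing rightwards up to [-1]. *)
Lemma fourier_neg (b : nat -> R) (M : nat) : b 0%nat = 0 -> (forall k, 0 <= b k) ->
  forall j, Z.lt j 0 -> fourier b M j = 0.
Proof.
move=> b0 b_ge0.
set B := sum_f_R0 b M; set S := PI * exp (cos_sum b M 0).
have B_ge0 : 0 <= B by apply: cond_pos_sum.
(* [2 B + 1] makes [B / |j| <= 1 / 2], so each pass through the recurrence halves the bound. *)
have decay m : forall j, IZR j <= - (2 * B + 1) -> Rabs (fourier b M j) <= S * (/ 2) ^ m.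
  elim: m => [|m IH] j Hj; first by rewrite /= Rmult_1_r; exact: fourier_bounded.
  have H1 : Rabs (IZR j * fourier b M j) <= B * (S * (/ 2) ^ m).
    rewrite fourier_rec //; apply: Rle_trans (Rsum_abs _ _) _.
    rewrite Rmult_comm /B scal_sum; apply: sum_Rle => k _.
    rewrite Rabs_mult (Rabs_pos_eq (b k)) //.
    apply: Rmult_le_compat_l => //; apply: IH.
    rewrite minus_IZR -INR_IZR_INZ; have := pos_INR k; lra.
  rewrite Rabs_mult (Rabs_left1 (IZR j)) in H1; last by lra.
  have := Rabs_pos (fourier b M j); rewrite /=.
  set x := Rabs _ in H1 *; set y := S * _ in H1 *.
  have -> : S * (/ 2 * (/ 2) ^ m) = y / 2 by rewrite /y; field.
  have y_ge0 : 0 <= y.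
    apply: Rmult_le_pos; last by apply: pow_le; lra.
    by apply: Rmult_le_pos; [have := PI_RGT_0; lra | apply: Rlt_le; exact: exp_pos].
  move=> x_ge0; have : (2 * B + 1) * x <= - IZR j * x by apply: Rmult_le_compat_r => //; lra.
  nra.
have far j : IZR j <= - (2 * B + 1) -> fourier b M j = 0.
  move=> Hj; case: (Req_dec (fourier b M j) 0) => // /Rabs_pos_lt Hpos.
  have S_gt0 : 0 < S by apply: Rmult_lt_0_compat; [exact: PI_RGT_0 | exact: exp_pos].
  have half_lt1 : Rabs (/ 2) < 1 by rewrite Rabs_pos_eq; lra.
  have [m Hm] := pow_lt_1_zero (/ 2) half_lt1 _ (Rdiv_lt_0_compat _ _ Hpos S_gt0).
  have := Hm m (le_n m); rewrite Rabs_pos_eq; last by apply: pow_le; lra.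
  move=> /(Rmult_lt_compat_l S _ _ S_gt0).
  have -> : S * (Rabs (fourier b M j) / S) = Rabs (fourier b M j) by field; lra.
  by have := decay m j Hj; lra.
have near (d : nat) : forall j, Z.lt j 0 -> IZR j <= - (2 * B + 1) + INR d -> fourier b M j = 0.
  elim: d => [|d IH] j Hj; first by rewrite Rplus_0_r; exact: far.
  rewrite S_INR => Hd.
  have : IZR j * fourier b M j = 0.
    rewrite fourier_rec //; apply: sum_eq_R0 => k _.
    case: k => [|k]; first by rewrite b0 Rmult_0_l.
    rewrite IH ?Rmult_0_r //; first by lia.
    by rewrite minus_IZR -INR_IZR_INZ S_INR; have := pos_INR k; lra.
  have := IZR_lt _ _ Hj; nra.
move=> j Hj; apply: (near (Z.to_nat (up (2 * B + 1)))) => //.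
have [Hup _] := archimed (2 * B + 1).
rewrite INR_IZR_INZ Z2Nat.id; last by apply: le_IZR; lra.
have : IZR j <= -1 by apply: (IZR_le _ (-1)); lia.
lra.
Qed.

Lemma sum_f_R0_truncate (g : nat -> R) (m M : nat) : (m <= M)%coq_nat ->
  (forall k, (m < k)%coq_nat -> g k = 0) -> sum_f_R0 g M = sum_f_R0 g m.
Proof.
move=> Hle Hg; elim: Hle => // M' Hle IH.
by rewrite tech5 IH Hg ?Rplus_0_r //; lia.
Qed.

(** Up to the factor [fourier b M 0], the Fourier coefficients and
    [N j * r ^ j] obey the same recurrence.  Truncating the weights at [M] does
    not affect indices [j <= M].  The sign of the factor is settled only by
    [saddle_point_positive]. *)
Lemma fourier_coef (s N : nat -> R) (r : R) (M : nat) :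
  s 0%nat = 0 -> (forall k, 0 <= s k) -> 0 < r -> N 0%nat = 1 ->
  (forall n, INR n * N n = sum_f_R0 (fun k => s k * N (n - k)%nat) n) ->
  let b k := s k * r ^ k in
  forall j, (j <= M)%coq_nat -> fourier b M (Z.of_nat j) = fourier b M 0 * (N j * r ^ j).
Proof.
move=> s0 s_ge0 r_gt0 N0 N_rec b.
have b0 : b 0%nat = 0 by rewrite /b s0 Rmult_0_l.
have b_ge0 k : 0 <= b k by apply: Rmult_le_pos => //; apply: pow_le; lra.
elim/(well_founded_induction lt_wf) => j IH Hj.
case: j IH Hj => [|j] IH Hj; first by rewrite N0 /= !Rmult_1_r.
have Hpos : 0 < INR j.+1 by apply: lt_0_INR; lia.
apply: (Rmult_eq_reg_l (INR j.+1)); last by lra.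
rewrite [in LHS]INR_IZR_INZ fourier_rec // (sum_f_R0_truncate _ j.+1) //; last first.
  by move=> k Hk; rewrite fourier_neg ?Rmult_0_r //; lia.
have -> : INR j.+1 * (fourier b M 0 * (N j.+1 * r ^ j.+1))
        = fourier b M 0 * r ^ j.+1 * (INR j.+1 * N j.+1) by ring.
rewrite N_rec scal_sum; apply: PartSum.sum_eq => k Hk.
case: k Hk => [|k] Hk; first by rewrite b0 s0; ring.
have -> : Z.sub (Z.of_nat j.+1) (Z.of_nat k.+1) = Z.of_nat (j.+1 - k.+1)%nat by lia.
rewrite IH; [ | lia | lia ].
have -> : r ^ j.+1 = r ^ k.+1 * r ^ (j.+1 - k.+1)%nat by rewrite -pow_add; congr (r ^ _); lia.
rewrite /b; ring.
Qed.

(** Passing from [j] to [j - 1] and [j + 1] multiplies by [e^(i t)] and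
    [e^(- i t)], whose sum is [2 cos t]. *)
Lemma fourier_second_difference (b : nat -> R) (M : nat) (j : Z) : b 0%nat = 0 ->
  RInt (fun t => wave b M j t * (2 * (1 - cos t))) 0 PI
  = 2 * fourier b M j - fourier b M (j + 1) - fourier b M (j - 1).
Proof.
move=> b0.
have -> : 2 * fourier b M j - fourier b M (j + 1) - fourier b M (j - 1) =
  minus (minus (scal 2 (fourier b M j)) (fourier b M (j + 1))) (fourier b M (j - 1)) by [].
apply: is_RInt_unique.
apply: (is_RInt_ext (fun t =>
  minus (minus (scal 2 (wave b M j t)) (wave b M (j + 1) t)) (wave b M (j - 1) t))).
  move=> t _; rewrite /wave /Hierarchy.minus /Hierarchy.plus /Hierarchy.opp.
  rewrite /Hierarchy.scal /= /Hierarchy.mult /= plus_IZR minus_IZR.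
  set x := sin_sum b M t - IZR j * t.
  have -> : sin_sum b M t - (IZR j + 1) * t = x - t by rewrite /x; ring.
  have -> : sin_sum b M t - (IZR j - 1) * t = x + t by rewrite /x; ring.
  rewrite cos_minus cos_plus; ring.
have C i : is_RInt (wave b M i) 0 PI (fourier b M i) by apply: RInt_correct; exact: ex_RInt_wave.
apply: (is_RInt_minus (V := R_NormedModule)) => //.
apply: (is_RInt_minus (V := R_NormedModule)) => //.
exact: (is_RInt_scal (V := R_NormedModule)).
Qed.

(** * Elementary estimates *)

Lemma pow_exp_bound (x : R) (m : nat) : 0 <= x -> x ^ m * exp (- x) <= INR (Factorial.fact m).
Proof.
move=> x_ge0.
have Hf : 0 < INR (Factorial.fact m) by exact: INR_fact_lt_0.
have H : x ^ m / INR (Factorial.fact m) <= exp x.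
  apply: Rle_trans (exp_ge_taylor x m x_ge0).
  case: m Hf => [|m] Hf; first exact: Rle_refl.
  rewrite tech5 -[X in X <= _]Rplus_0_l; apply: Rplus_le_compat_r.
  apply: cond_pos_sum => k; apply: Rdiv_le_0_compat; [exact: pow_le | exact: INR_fact_lt_0].
have He := exp_pos (- x); have E : exp x * exp (- x) = 1 by rewrite -exp_plus Rplus_opp_r exp_0.
have -> : INR (Factorial.fact m) = INR (Factorial.fact m) * (exp x * exp (- x)) by rewrite E Rmult_1_r.
rewrite -Rmult_assoc; apply: Rmult_le_compat_r; first exact: Rlt_le.
have -> : x ^ m = INR (Factorial.fact m) * (x ^ m / INR (Factorial.fact m)) by field; lra.
by apply: Rmult_le_compat_l => //; exact: Rlt_le.
Qed.

(** [r ^ k] decays faster than any power once [k] exceeds [1 / (1 - r)]. *)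
Lemma pow_geom_bound (r : R) (k m : nat) : 0 < r < 1 ->
  (INR k * (1 - r)) ^ m * r ^ k <= INR (Factorial.fact m).
Proof.
move=> r01.
have H0 : 0 <= INR k * (1 - r) by apply: Rmult_le_pos; [exact: pos_INR | lra].
apply: Rle_trans (pow_exp_bound _ m H0).
apply: Rmult_le_compat_l; first exact: pow_le.
have -> : exp (- (INR k * (1 - r))) = (exp (r - 1)) ^ k.
  elim: k {H0} => [|k IH]; first by rewrite /= Rmult_0_l Ropp_0 exp_0.
  rewrite [RHS]/= -IH -exp_plus S_INR; congr exp; ring.
by apply: pow_incr; have := exp_ineq1_le (r - 1); lra.
Qed.

Lemma pow_bernoulli (r : R) (k : nat) : 0 <= r <= 1 -> 1 - INR k * (1 - r) <= r ^ k.
Proof.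
move=> r01; elim: k => [|k IH]; first by rewrite /=; lra.
rewrite S_INR /=.
have : r ^ k <= 1 by rewrite -(pow1 k); apply: pow_incr; lra.
have := pow_le r k (proj1 r01); nra.
Qed.

Lemma sum_monotone (f : nat -> R) (m M : nat) : (m <= M)%coq_nat ->
  (forall k, 0 <= f k) -> sum_f_R0 f m <= sum_f_R0 f M.
Proof.
move=> Hle Hf; elim: Hle => [|M' Hle IH]; first exact: Rle_refl.
by rewrite tech5; have := Hf M'.+1; lra.
Qed.

Lemma sum_inv_sq (M : nat) : sum_f_R0 (fun k => / INR k ^ 2) M <= 2.
Proof.
have H m : sum_f_R0 (fun k => / INR k ^ 2) m.+1 <= 2 - / INR m.+1.
  elim: m => [|m IH].
    by rewrite /= !Rmult_0_l Rinv_0; field_simplify; lra.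
  rewrite tech5; apply: Rle_trans (Rplus_le_compat_r _ _ _ IH) _.
  set x := INR m.+1.
  have x_gt0 : 0 < x by apply: lt_0_INR; lia.
  have -> : INR m.+2 = x + 1 by rewrite S_INR.
  have : / (x + 1) ^ 2 <= / x - / (x + 1).
    have -> : / x - / (x + 1) = / (x * (x + 1)) by field; lra.
    apply: Rinv_le_contravar; nra.
  lra.
case: M => [|M]; first by rewrite /= Rmult_0_l Rinv_0; lra.
by have := H M; have := Rinv_0_lt_compat (INR M.+1) (lt_0_INR _ (Nat.lt_0_succ M)); lra.
Qed.

Lemma sum_linear (f g : nat -> R) (a c : R) (M : nat) :
  sum_f_R0 (fun k => a * f k + c * g k) M = a * sum_f_R0 f M + c * sum_f_R0 g M.
Proof. by elim: M => [|M IH] //; rewrite !tech5 IH; ring. Qed.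

Lemma one_sub_cos (x : R) : 1 - cos x = 2 * (sin (x / 2)) ^ 2.
Proof.
have -> : cos x = cos (2 * (x / 2)) by congr cos; field.
rewrite cos_2a_sin; ring.
Qed.

Lemma sin_sub_id (x : R) : 0 <= x -> Rabs (sin x - x) <= 2 * x ^ 3.
Proof.
move=> x_ge0.
have up : sin x <= x.
  by case: x_ge0 => [/sin_lt_x/Rlt_le | <-] //; rewrite sin_0; lra.
rewrite Rabs_left1; last by lra.
case: (Rle_lt_dec x 1) => Hx; last first.
  have [H _] := SIN_bound x.
  have : x <= x ^ 3 by rewrite /=; nra.
  have : 1 <= x ^ 3 by rewrite /=; nra.
  lra.
have [lb _] := SIN x x_ge0 ltac:(have := PI2_1; lra).
move: lb; rewrite /sin_lb /sin_approx /sin_term /=.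
set p := x * (x * (x * 1)).
have p_ge0 : 0 <= p by rewrite /p Rmult_1_r; apply: Rmult_le_pos => //; apply: Rmult_le_pos.
have Hs : 0 <= x * x <= 1 by nra.
have -> : x * (x * (x * (x * (x * (x * (x * 1)))))) = p * (x * x) * (x * x) by rewrite /p; ring.
have -> : x * (x * (x * (x * (x * 1)))) = p * (x * x) by rewrite /p; ring.
set q := p * (x * x).
have q_ge0 : 0 <= q by rewrite /q; nra.
have : q * (x * x) <= q by nra.
lra.
Qed.

Lemma one_sub_cos_le (x : R) : 1 - cos x <= x ^ 2 / 2.
Proof.
rewrite one_sub_cos.
have H : Rabs (sin (x / 2)) <= Rabs (x / 2).
  have pos z : 0 <= z -> Rabs (sin z) <= z.
    move=> z_ge0; apply/Rabs_le; case: (Rle_lt_dec z 1) => Hz.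
      have [] := sin_bound z 0 z_ge0 ltac:(have := PI2_1; lra).
      have : 0 <= sin z by apply: sin_ge_0 => //; have := PI2_1; lra.
      by case: z_ge0 => [/sin_lt_x | <-]; rewrite ?sin_0; lra.
    by have := SIN_bound z; lra.
  case: (Rle_lt_dec 0 (x / 2)) => Hx; first by rewrite (Rabs_pos_eq (x / 2)) //; exact: pos.
  rewrite -(Ropp_involutive (x / 2)) sin_neg Rabs_Ropp (Rabs_Ropp (- _)) (Rabs_pos_eq (- _)).
    by apply: pos; lra.
  lra.
have := pow_incr _ _ 2 (conj (Rabs_pos _) H); rewrite !pow2_abs; lra.
Qed.

Lemma one_sub_cos_ge (x : R) : 0 <= x <= 1 -> x ^ 2 / 8 <= 1 - cos x.
Proof.
move=> Hx; rewrite one_sub_cos.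
have := sin_sub_id (x / 2) ltac:(lra).
move=> /Rabs_le_between [lb _].
have : x / 4 <= sin (x / 2).
  have : 2 * (x / 2) ^ 3 <= x / 4 by rewrite /=; nra.
  lra.
move=> H; have := pow_incr _ _ 2 (conj (_ : 0 <= x / 4) H); rewrite /=; lra.
Qed.

Lemma cos_ge_half (x : R) : Rabs x <= 1 -> 1 / 2 <= cos x.
Proof.
move=> Hx; have := one_sub_cos_le x; rewrite -(pow2_abs x).
have := pow_incr _ _ 2 (conj (Rabs_pos x) Hx); rewrite pow1; lra.
Qed.

(** Real part of the geometric sum of [(r e^(i t))^k], with the denominator
    [|1 - r e^(i t)|^2] cleared. *)
Lemma geom_cos_sum (r t : R) (M : nat) :
  (1 - 2 * r * cos t + r ^ 2) * sum_f_R0 (fun k => r ^ k * cos (INR k * t)) M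
  = 1 - r * cos t - r ^ M.+1 * cos (INR M.+1 * t) + r ^ M.+2 * cos (INR M * t).
Proof.
elim: M => [|M IH].
  by rewrite /= !Rmult_0_l cos_0 !Rmult_1_l; ring.
rewrite tech5 Rmult_plus_distr_l IH.
have E : cos (INR M.+2 * t) + cos (INR M * t) = 2 * cos t * cos (INR M.+1 * t).
  have -> : INR M.+2 * t = INR M.+1 * t + t by rewrite (S_INR M.+1); ring.
  have -> : INR M * t = INR M.+1 * t - t by rewrite (S_INR M); ring.
  rewrite cos_plus cos_minus; ring.
have -> : cos (INR M * t) = 2 * cos t * cos (INR M.+1 * t) - cos (INR M.+2 * t) by lra.
rewrite /=; ring.
Qed.

(** Away from [t = 0] the series [\sum_k r^k e^(i k t)] is much smaller than
    its value at [t = 0]; the last term on the left bounds the effect of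
    truncation at [M]. *)
Lemma geom_cos_gap (r t : R) (M : nat) : 0 < r < 1 ->
  r * (1 + r) * (1 - cos t) / ((1 - r) * (1 - 2 * r * cos t + r ^ 2))
   - 3 * r ^ M.+1 / (1 - r) ^ 2
  <= sum_f_R0 (fun k => r ^ k * (1 - cos (INR k * t))) M.
Proof.
move=> r01; set D := 1 - 2 * r * cos t + r ^ 2.
have D_ge : (1 - r) ^ 2 <= D.
  by rewrite /D; have [_] := COS_bound t; rewrite /=; nra.
have y2_gt0 : 0 < (1 - r) ^ 2 by apply: pow_lt; lra.
have D_gt0 : 0 < D by lra.
have -> : sum_f_R0 (fun k => r ^ k * (1 - cos (INR k * t))) M
  = sum_f_R0 (fun k => r ^ k) M - sum_f_R0 (fun k => r ^ k * cos (INR k * t)) M.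
  by rewrite -minus_sum; apply: PartSum.sum_eq => k _; ring.
have := geom_cos_sum r t M; rewrite -/D => G.
have -> : sum_f_R0 (fun k => r ^ k * cos (INR k * t)) M =
  (1 - r * cos t - r ^ M.+1 * cos (INR M.+1 * t) + r ^ M.+2 * cos (INR M * t)) / D.
  by rewrite -G; field; lra.
rewrite tech3; last by lra.
have -> : r * (1 + r) * (1 - cos t) / ((1 - r) * D) = / (1 - r) - (1 - r * cos t) / D.
  by rewrite /D; field; split; [rewrite -/D; lra | lra].
have p_gt0 : 0 < r ^ M.+1 by apply: pow_lt; lra.
have I1 : r ^ M.+1 / (1 - r) <= r ^ M.+1 / (1 - r) ^ 2.
  apply: Rmult_le_compat_l; first exact: Rlt_le.
  by apply: Rinv_le_contravar => //; rewrite /=; nra.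
have I2 : (- r ^ M.+1 * cos (INR M.+1 * t) + r ^ M.+2 * cos (INR M * t)) / D
         <= 2 * r ^ M.+1 / (1 - r) ^ 2.
  apply: (Rle_trans _ (2 * r ^ M.+1 / D)).
    apply: Rmult_le_compat_r; first by apply: Rlt_le; exact: Rinv_0_lt_compat.
    have -> : r ^ M.+2 = r * r ^ M.+1 by [].
    have := COS_bound (INR M.+1 * t); have := COS_bound (INR M * t).
    set u := cos _; set v := cos _; move: p_gt0; set p := r ^ _ => p_gt0 Hu Hv.
    have : r * p * u <= p.
      have : r * u <= 1 by nra.
      nra.
    nra.
  apply: Rmult_le_compat_l; first by lra.
  exact: Rinv_le_contravar.
have -> : (1 - r ^ M.+1) / (1 - r) = / (1 - r) - r ^ M.+1 / (1 - r) by field; lra.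
have -> : (1 - r * cos t - r ^ M.+1 * cos (INR M.+1 * t) + r ^ M.+2 * cos (INR M * t)) / D
  = (1 - r * cos t) / D + (- r ^ M.+1 * cos (INR M.+1 * t) + r ^ M.+2 * cos (INR M * t)) / D.
  by field; lra.
have -> : 3 * r ^ M.+1 / (1 - r) ^ 2 = r ^ M.+1 / (1 - r) ^ 2 + 2 * r ^ M.+1 / (1 - r) ^ 2.
  by field; lra.
lra.
Qed.

(** * Positivity of the saddle-point integral *)

(** The saddle-point argument in abstract form: a window [[0, t0]] on which the
    phase is at most [1], decay [exp (- L)] outside it, and a Gaussian lower
    bound of width [t1] inside it.  The integrand is nonnegative on the window,
    so only the stretch [[t1 / 2, t1]] has to be estimated from below.  The weight
    [W] is kept general because both [2 (1 - cos t)] and a constant are used. *)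
Lemma wave_integral_pos (b : nat -> R) (M : nat) (n : Z) (V t0 t1 L : R) (W : R -> R) :
  b 0%nat = 0 ->
  (forall t, 0 <= t <= t0 -> Rabs (sin_sum b M t - IZR n * t) <= 1) ->
  (forall t, t0 <= t <= PI -> L <= cos_sum b M 0 - cos_sum b M t) ->
  (forall t, cos_sum b M 0 - cos_sum b M t <= V * t ^ 2 / 2) ->
  0 < t1 <= t0 -> t1 <= 1 -> V * t1 ^ 2 <= 1 -> 4096 * exp (- L) < t1 ^ 3 ->
  (forall t, continuous W t) ->
  (forall t, 1 - cos t <= W t <= 4) ->
  0 < RInt (fun t => wave b M n t * W t) 0 PI.
Proof.
move=> b0 Hphase Hdecay Hquad Ht1 Ht1' HV HL Wc HW.
set F := fun t => wave b M n t * W t.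
set E0 := exp (cos_sum b M 0).
have E0_gt0 : 0 < E0 by exact: exp_pos.
have Fc t : continuous F t.
  apply: (continuous_mult (K := R_AbsRing)); [exact: continuous_wave | exact: Wc].
have Fint u v : ex_RInt F u v by exact: ex_RInt_continuous_all.
have W0 t : 0 <= W t by have := HW t; have := COS_bound t; lra.
have PI4 := PI_4; have PI2 := PI2_1.
have EL := exp_pos (- L).
(* Outside the window: [|cos| <= 1] and [W <= 4]. *)
have low t : 0 <= t <= PI -> - (4 * (E0 * exp (- L))) <= F t.
  move=> Ht; case: (Rle_lt_dec t t0) => Htt.
    have H : 0 <= F t.
      apply: Rmult_le_pos => //; apply: Rmult_le_pos; first by apply: Rlt_le; exact: exp_pos.
      by have := cos_ge_half _ (Hphase t (conj (proj1 Ht) Htt)); lra.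
    have : 0 <= E0 * exp (- L) by apply: Rmult_le_pos; lra.
    lra.
  have He : exp (cos_sum b M t) <= E0 * exp (- L).
    rewrite /E0 -exp_plus; apply: exp_le_compat.
    by have := Hdecay t ltac:(lra); lra.
  rewrite /F /wave.
  have := exp_pos (cos_sum b M t).
  have := COS_bound (sin_sum b M t - IZR n * t).
  have := W0 t; have := proj2 (HW t).
  set e := exp (cos_sum b M t) in He *; set c := cos _; set w := W t => ? ? ? ?.
  have : - (4 * e) <= e * c * w; last by lra.
  have : - 4 <= c * w by nra.
  nra.
(* On [[t1 / 2, t1]]: [exp (- 1 / 2) >= 1 / 2], [cos >= 1 / 2] and [W >= t1 ^ 2 / 32]. *)
have high t : t1 / 2 <= t <= t1 -> E0 * (t1 ^ 2 / 128) <= F t.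
  move=> Ht; rewrite /F /wave.
  have Hc := cos_ge_half _ (Hphase t ltac:(lra)).
  have Hw : t1 ^ 2 / 32 <= W t.
    have := proj1 (HW t); have := one_sub_cos_ge t ltac:(lra).
    have := pow_incr _ _ 2 (conj (_ : 0 <= t1 / 2) (proj1 Ht)); rewrite /=; lra.
  have He : E0 / 2 <= exp (cos_sum b M t).
    have -> : cos_sum b M t = cos_sum b M 0 + (cos_sum b M t - cos_sum b M 0) by ring.
    rewrite exp_plus; apply: Rmult_le_compat_l; first by lra.
    apply: Rle_trans (exp_ineq1_le _).
    have := Hquad t.
    have : t ^ 2 <= t1 ^ 2 by apply: pow_incr; lra.
    case: (Rle_lt_dec 0 V) => HV0; have := pow2_ge_0 t; nra.
  have -> : E0 * (t1 ^ 2 / 128) = (E0 / 2 * (1 / 2)) * (t1 ^ 2 / 32) by field.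
  apply: Rmult_le_compat => //; first by lra.
    by have := pow2_ge_0 t1; lra.
  by apply: Rmult_le_compat => //; lra.
have const u v c : is_RInt (fun _ => c) u v ((v - u) * c).
  exact: (is_RInt_const (V := R_NormedModule)).
have lowint u v : 0 <= u <= v -> v <= PI -> (v - u) * - (4 * (E0 * exp (- L))) <= RInt F u v.
  move=> Huv Hv; rewrite -(is_RInt_unique _ _ _ _ (const u v _)).
  apply: RInt_le => //; first by lra.
    by eexists; exact: const.
  by move=> t Ht; apply: low; lra.
have highint : (t1 - t1 / 2) * (E0 * (t1 ^ 2 / 128)) <= RInt F (t1 / 2) t1.
  rewrite -(is_RInt_unique _ _ _ _ (const (t1 / 2) t1 _)).
  apply: RInt_le => //; first by lra.
    by eexists; exact: const.
  by move=> t Ht; apply: high; lra.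
rewrite -(RInt_Chasles F 0 (t1 / 2) PI) // -(RInt_Chasles F (t1 / 2) t1 PI) // /Hierarchy.plus /=.
have := lowint 0 (t1 / 2) ltac:(lra) ltac:(lra).
have := lowint t1 PI ltac:(lra) ltac:(lra).
have := Rmult_lt_compat_l _ _ _ E0_gt0 HL.
move: highint; rewrite /=.
have : (PI - t1 + t1 / 2) * (E0 * exp (- L)) <= 4 * (E0 * exp (- L)).
  by apply: Rmult_le_compat_r; [apply: Rmult_le_pos; lra | lra].
nra.
Qed.

(** When [\sum_k b k = n] the linear term of the phase cancels, leaving a cubic
    error controlled by the next moment. *)
Lemma phase_bound (b : nat -> R) (M : nat) (n t : R) : (forall k, 0 <= b k) -> b 0%nat = 0 ->
  sum_f_R0 b M = n -> 0 <= t ->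
  Rabs (sin_sum b M t - n * t) <= 2 * sum_f_R0 (fun k => INR k ^ 2 * b k) M * t ^ 3.
Proof.
move=> b_ge0 b0 <- t_ge0.
rewrite (Rmult_comm (sum_f_R0 b M)) (Rmult_comm 2) Rmult_assoc.
rewrite (Rmult_comm (sum_f_R0 (fun k => INR k ^ 2 * b k) M)) !scal_sum -minus_sum.
apply: Rle_trans (Rsum_abs _ _) _; apply: sum_Rle => k _.
have -> : b k / INR k * sin (INR k * t) - b k * t = b k / INR k * (sin (INR k * t) - INR k * t).
  rewrite -{2}(INR_div_mul b k b0); ring.
have q_ge0 : 0 <= b k / INR k.
  case: k => [|k]; first by rewrite b0 /Rdiv Rmult_0_l; lra.
  by apply: Rdiv_le_0_compat => //; apply: lt_0_INR; lia.
rewrite Rabs_mult (Rabs_pos_eq _ q_ge0) -{2}(INR_div_mul b k b0).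
have := sin_sub_id (INR k * t) (Rmult_le_pos _ _ (pos_INR k) t_ge0).
move=> /(Rmult_le_compat_l _ _ _ q_ge0); rewrite /=; lra.
Qed.

Lemma cos_gap_sum (b : nat -> R) (M : nat) (t : R) :
  cos_sum b M 0 - cos_sum b M t = sum_f_R0 (fun k => b k / INR k * (1 - cos (INR k * t))) M.
Proof.
by rewrite /cos_sum -minus_sum; apply: PartSum.sum_eq => k _; rewrite Rmult_0_r cos_0; ring.
Qed.

Lemma cos_gap_le (b : nat -> R) (M : nat) (t : R) : (forall k, 0 <= b k) -> b 0%nat = 0 ->
  cos_sum b M 0 - cos_sum b M t <= sum_f_R0 (fun k => INR k * b k) M * t ^ 2 / 2.
Proof.
move=> b_ge0 b0; rewrite cos_gap_sum /Rdiv Rmult_assoc (Rmult_comm (sum_f_R0 _ _)) scal_sum.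
apply: sum_Rle => k _.
have q_ge0 : 0 <= b k / INR k.
  case: k => [|k]; first by rewrite b0 /Rdiv Rmult_0_l; lra.
  by apply: Rdiv_le_0_compat => //; apply: lt_0_INR; lia.
rewrite -{2}(INR_div_mul b k b0).
have := Rmult_le_compat_l _ _ _ q_ge0 (one_sub_cos_le (INR k * t)); rewrite /=; lra.
Qed.

(** Each power of [k] costs one power of [Y = 1 / (1 - r)]; the two extra powers
    pay for the convergent factor [1 / k ^ 2]. *)
Lemma moment_le (s : nat -> R) (A a : nat) (B r Y : R) (M : nat) :
  s 0%nat = 0 -> (forall k, s k <= B * INR k ^ A) -> 0 <= B ->
  0 < r < 1 -> (1 - r) * Y = 1 ->
  sum_f_R0 (fun k => INR k ^ a * (s k * r ^ k)) M
  <= 2 * (B * INR (Factorial.fact (A + a + 2)) * Y ^ (A + a + 2)).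
Proof.
move=> s0 s_le B_ge0 r01 HY.
set m := (A + a + 2)%nat; set c := _ * Y ^ m.
have Y_gt0 : 0 < Y by nra.
have c_ge0 : 0 <= c.
  by do !apply: Rmult_le_pos => //; [exact: pos_INR | apply: pow_le; lra].
apply: (Rle_trans _ (sum_f_R0 (fun k => / INR k ^ 2 * c) M)); last first.
  rewrite -scal_sum; have := sum_inv_sq M; nra.
apply: sum_Rle => k _; case: k => [|k].
  by rewrite s0 !Rmult_0_l Rmult_0_r /= Rmult_0_l Rinv_0; lra.
set x := INR k.+1; have x_gt0 : 0 < x by apply: lt_0_INR; lia.
have H := pow_geom_bound r k.+1 m r01; rewrite -/x in H.
have Hr : 0 < r ^ k.+1 by apply: pow_lt; lra.
have E : x ^ m * r ^ k.+1 <= INR (Factorial.fact m) * Y ^ m.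
  have -> : x ^ m * r ^ k.+1 = ((x * (1 - r)) ^ m * r ^ k.+1) * Y ^ m.
    have -> : x ^ m = (x * (1 - r)) ^ m * Y ^ m by rewrite -Rpow_mult_distr Rmult_assoc HY Rmult_1_r.
    ring.
  by apply: Rmult_le_compat_r => //; apply: pow_le; lra.
apply: (Rle_trans _ (x ^ a * (B * x ^ A * r ^ k.+1))).
  apply: Rmult_le_compat_l; first by apply: pow_le; lra.
  by apply: Rmult_le_compat_r; [lra | exact: s_le].
have -> : x ^ a * (B * x ^ A * r ^ k.+1) = / x ^ 2 * (B * (x ^ m * r ^ k.+1)).
  have -> : x ^ m = x ^ A * x ^ a * x ^ 2 by rewrite /m -!pow_add.
  by field; lra.
apply: Rmult_le_compat_l; first by apply: Rlt_le; apply: Rinv_0_lt_compat; exact: pow_lt.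
by rewrite /c Rmult_assoc; exact: Rmult_le_compat_l.
Qed.

(** Beyond [X ^ 11 = (1 - r) ^ (- 11 / 10)] every weighted term is negligible:
    there [(k (1 - r)) ^ 11 >= k], so [r ^ k] beats any fixed power of [k]. *)
Lemma tail_term (s : nat -> R) (A : nat) (B r X : R) (k : nat) :
  s k <= B * INR k ^ A -> 0 <= B -> 0 < r < 1 -> 0 < X -> (1 - r) * X ^ 10 = 1 ->
  X ^ 11 <= INR k ->
  INR k ^ 2 * (s k * r ^ k) <= B * INR (Factorial.fact (11 * (A + 4))) * / INR k ^ 2.
Proof.
move=> s_le B_ge0 r01 X_gt0 HX Hk; set x := INR k in s_le Hk *.
have x_gt0 : 0 < x by apply: Rlt_le_trans Hk; exact: pow_lt.
have Hr : 0 < r ^ k by apply: pow_lt; lra.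
have H1 : x <= (x * (1 - r)) ^ 11.
  have E : x ^ 11 = (x * (1 - r)) ^ 11 * (X ^ 10) ^ 11.
    by rewrite -Rpow_mult_distr Rmult_assoc HX Rmult_1_r.
  have H10 : (X ^ 11) ^ 10 <= x ^ 10.
    by apply: pow_incr; split=> //; apply: Rlt_le; exact: pow_lt.
  have P : 0 < (X ^ 11) ^ 10 by do 2 apply: pow_lt.
  have EX : (X ^ 10) ^ 11 = (X ^ 11) ^ 10 by rewrite -[LHS]pow_mult -[RHS]pow_mult.
  apply: (Rmult_le_reg_r ((X ^ 11) ^ 10)) => //.
  rewrite -{2}EX -E.
  have -> : x ^ 11 = x * x ^ 10 by [].
  by apply: Rmult_le_compat_l; lra.
have H2 : x ^ (A + 4) * r ^ k <= INR (Factorial.fact (11 * (A + 4))).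
  apply: Rle_trans (pow_geom_bound r k (11 * (A + 4)) r01); rewrite pow_mult.
  apply: Rmult_le_compat_r; first by lra.
  by apply: pow_incr; rewrite -/x; split; [exact: Rlt_le | exact: H1].
apply: (Rle_trans _ (x ^ 2 * (B * x ^ A * r ^ k))).
  apply: Rmult_le_compat_l; first by apply: pow_le; lra.
  by apply: Rmult_le_compat_r; lra.
have -> : x ^ 2 * (B * x ^ A * r ^ k) = B * (x ^ (A + 4) * r ^ k) * / x ^ 2.
  have -> : x ^ (A + 4) = x ^ A * x ^ 2 * x ^ 2 by rewrite -!pow_add; congr pow; lia.
  by field; lra.
apply: Rmult_le_compat_r; first by apply: Rlt_le; apply: Rinv_0_lt_compat; exact: pow_lt.
exact: Rmult_le_compat_l.
Qed.

(** For [k <= 1 / (2 (1 - r))] Bernoulli's inequality gives [r ^ k >= 1 / 2], so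
    the power sum up to there survives. *)
Lemma half_range_sum (f : nat -> R) (r : R) (m M : nat) : (forall k, 0 <= f k) ->
  0 < r < 1 -> (m <= M)%coq_nat -> INR m * (1 - r) <= 1 / 2 ->
  sum_f_R0 f m / 2 <= sum_f_R0 (fun k => f k * r ^ k) M.
Proof.
move=> f_ge0 r01 HmM Hm.
apply: (Rle_trans _ (sum_f_R0 (fun k => f k * r ^ k) m)); last first.
  apply: sum_monotone => // k; apply: Rmult_le_pos => //; apply: pow_le; lra.
rewrite /Rdiv Rmult_comm scal_sum; apply: sum_Rle => k Hk.
apply: Rmult_le_compat_l => //.
apply: Rle_trans (pow_bernoulli r k _); last by lra.
have := le_INR _ _ Hk; nra.
Qed.

Lemma sum_id (m : nat) : sum_f_R0 INR m = INR m * (INR m + 1) / 2.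
Proof. elim: m => [|m IH]; rewrite ?tech5 ?IH ?S_INR /=; field. Qed.

Lemma sum_sq_ge (m : nat) : INR m ^ 3 / 3 <= sum_f_R0 (fun k => INR k ^ 2) m.
Proof.
elim: m => [|m IH]; first by rewrite /=; lra.
rewrite tech5 S_INR; have := pos_INR m; move: IH; rewrite /=; nra.
Qed.

Lemma half_floor (Y : R) : 4 <= Y -> exists m : nat, Y / 4 <= INR m <= Y / 2.
Proof.
move=> HY; have [m Hm] := nfloor_ex (Y / 2) ltac:(lra).
exists m; lra.
Qed.

(** Terms up to [Y / 2] keep half of their weight.  If [M] were smaller than some
    [m] in [[Y / 4, Y / 2]], the whole sum would be too large for the hypothesis;
    so the terms up to [m] are present and give the bound. *)
Lemma first_moment_ge (s : nat -> R) (r Y : R) (M : nat) : (forall k, INR k <= s k) ->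
  0 < r < 1 -> (1 - r) * Y = 1 -> 4 <= Y ->
  sum_f_R0 (fun k => s k * r ^ k) M + 1 <= INR M ->
  Y ^ 2 / 64 <= sum_f_R0 (fun k => s k * r ^ k) M.
Proof.
move=> s_ge r01 HY HY4 Hsum.
have base m : (m <= M)%coq_nat -> INR m * (1 - r) <= 1 / 2 ->
   INR m * (INR m + 1) / 4 <= sum_f_R0 (fun k => s k * r ^ k) M.
  move=> HmM Hm.
  have := half_range_sum INR r m M pos_INR r01 HmM Hm; rewrite sum_id => H.
  apply: (Rle_trans _ (sum_f_R0 (fun k => INR k * r ^ k) M)); first by lra.
  apply: sum_Rle => k _; apply: Rmult_le_compat_r => //; apply: pow_le; lra.
have [m Hm] := half_floor Y HY4.
have Hmr : INR m * (1 - r) <= 1 / 2 by nra.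
case: (Nat.le_gt_cases m M) => HmM.
  have := base m HmM Hmr.
  have := pow_incr (Y / 4) (INR m) 2 ltac:(lra); rewrite /=; lra.
have HMm : INR M <= INR m by apply: le_INR; lia.
have HMr : INR M * (1 - r) <= 1 / 2 by nra.
(* [M (M + 1) / 4 <= M - 1] has no solution. *)
exfalso; have := base M (le_n M) HMr.
have := pow2_ge_0 (INR M - 3 / 2); rewrite /=; lra.
Qed.

Lemma second_moment_ge (s : nat -> R) (r Y : R) (M : nat) : (forall k, INR k <= s k) ->
  0 < r < 1 -> (1 - r) * Y = 1 -> 4 <= Y -> Y <= INR M ->
  Y ^ 3 / 400 <= sum_f_R0 (fun k => INR k * (s k * r ^ k)) M.
Proof.
move=> s_ge r01 HY HY4 HM.
have [m Hm] := half_floor Y HY4.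
have Hmr : INR m * (1 - r) <= 1 / 2 by nra.
have HmM : (m <= M)%coq_nat by apply: INR_le; lra.
apply: (Rle_trans _ (sum_f_R0 (fun k => INR k ^ 2 * r ^ k) M)); last first.
  apply: sum_Rle => k _.
  have := pos_INR k; have := s_ge k; have := pow_le r k ltac:(lra).
  set p := r ^ k => ? ? ?; rewrite /=.
  have : INR k * p <= s k * p by nra.
  nra.
apply: Rle_trans (half_range_sum (fun k => INR k ^ 2) r m M (fun k => pow2_ge_0 _) r01 HmM Hmr).
have := sum_sq_ge m.
have := pow_incr (Y / 4) (INR m) 3 ltac:(lra).
have : 0 <= Y ^ 3 by apply: pow_le; lra.
have -> : (Y / 4) ^ 3 = Y ^ 3 / 64 by field.
lra.
Qed.

(** The geometric series handles the angles beyond [1 / X ^ 11].  There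
    [1 - cos t >= 1 / (8 X ^ 22)] while [(1 - r) ^ 2 = 1 / X ^ 20], so the gap is at
    least [X ^ 10 / (16 X ^ 2)]; the truncation error is at most [1]. *)
Lemma geom_cos_gap_ge (r X t : R) (M : nat) :
  0 < r < 1 -> (1 - r) * X ^ 10 = 1 -> 4 <= X -> 3 * INR (Factorial.fact 21) <= X ->
  X ^ 11 <= INR M -> / X ^ 11 <= t <= PI ->
  X <= sum_f_R0 (fun k => r ^ k * (1 - cos (INR k * t))) M.
Proof.
move=> r01 HX HX4 HXf HM Ht.
have X_gt0 : 0 < X by lra.
have P11 : 0 < X ^ 11 by exact: pow_lt.
have P10 : 0 < X ^ 10 by exact: pow_lt.
have P2 : 0 < X ^ 2 by exact: pow_lt.
have P20 : 0 < X ^ 20 by exact: pow_lt.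
have P22 : 0 < X ^ 22 by exact: pow_lt.
have X2 : 4 <= X ^ 2 by rewrite /=; nra.
have X7 : 4 ^ 7 <= X ^ 7 by apply: pow_incr; lra.
have E8 : X ^ 8 = X * X ^ 7 by [].
have X9 : 4 <= X ^ 10.
  by apply: (Rle_trans _ _ _ HX4); rewrite -{1}(pow_1 X); apply: Rle_pow; [lra | lia].
have Hy : 1 - r = / X ^ 10 by apply: (Rmult_eq_reg_r (X ^ 10)); [rewrite HX; field; lra | lra].
have r_ge : 3 / 4 <= r by have := Rinv_le_contravar 4 (X ^ 10) ltac:(lra) X9; lra.
apply: Rle_trans (geom_cos_gap r t M r01).
have u_ge : / (8 * X ^ 22) <= 1 - cos t.
  have inv1 : 0 < / X ^ 11 <= 1.
    split; first exact: Rinv_0_lt_compat.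
    rewrite -Rinv_1; apply: Rinv_le_contravar; first by lra.
    have -> : X ^ 11 = X * X ^ 10 by []. 
    nra.
  have := one_sub_cos_ge (/ X ^ 11) ltac:(lra).
  have -> : (/ X ^ 11) ^ 2 / 8 = / (8 * X ^ 22).
    have -> : X ^ 22 = X ^ 11 * X ^ 11 by rewrite -pow_add.
    by field; lra.
  have := cos_decr_1 (/ X ^ 11) t ltac:(lra) ltac:(have := PI2_1; lra) ltac:(lra) ltac:(lra) (proj1 Ht).
  by rewrite /=; lra.
set u := 1 - cos t in u_ge *.
have u_gt0 : 0 < u by apply: Rlt_le_trans u_ge; apply: Rinv_0_lt_compat; lra.
have HD : 1 - 2 * r * cos t + r ^ 2 = (1 - r) ^ 2 + 2 * r * u by rewrite /u; ring.
have y2 : (1 - r) ^ 2 = / X ^ 20.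
  rewrite Hy; have -> : X ^ 20 = X ^ 10 * X ^ 10 by rewrite -pow_add.
  by field; lra.
have iX20 : 0 < / X ^ 20 by exact: Rinv_0_lt_compat.
have main : X ^ 8 / 16 <= r * (1 + r) * u / ((1 - r) * (1 - 2 * r * cos t + r ^ 2)).
  set i20 := / X ^ 20 in y2 iX20; rewrite HD y2.
  have D_gt0 : 0 < i20 + 2 * r * u by nra.
  apply: (Rmult_le_reg_r ((1 - r) * (i20 + 2 * r * u))).
    by apply: Rmult_lt_0_compat; lra.
  have -> : r * (1 + r) * u / ((1 - r) * (i20 + 2 * r * u)) *
     ((1 - r) * (i20 + 2 * r * u)) = r * (1 + r) * u by field; lra.
  have -> : X ^ 8 / 16 * ((1 - r) * (i20 + 2 * r * u))
          = (i20 + 2 * r * u) / (16 * X ^ 2).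
    rewrite Hy; have -> : X ^ 10 = X ^ 8 * X ^ 2 by rewrite -pow_add.
    field; have : 0 < X ^ 8 by exact: pow_lt.
    by lra.
  apply: (Rmult_le_reg_r (16 * X ^ 2)); first by lra.
  have -> : (i20 + 2 * r * u) / (16 * X ^ 2) * (16 * X ^ 2) = i20 + 2 * r * u by field; lra.
  have E : i20 = 8 * X ^ 2 * / (8 * X ^ 22).
    have -> : X ^ 22 = X ^ 20 * X ^ 2 by rewrite -pow_add.
    by rewrite /i20; field; lra.
  have H1 : i20 <= 8 * X ^ 2 * u by rewrite E; apply: Rmult_le_compat_l; lra.
  have H2 : u <= r * (1 + r) * u by nra.
  have H3 : 2 * r * u <= 2 * u by nra.
  have H4 : 4 * u <= X ^ 2 * u by nra.
  have H5 : X ^ 2 * u <= X ^ 2 * (r * (1 + r) * u) by nra.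
  lra.
have err : 3 * r ^ M.+1 / (1 - r) ^ 2 <= 1.
  rewrite y2.
  have -> : 3 * r ^ M.+1 / / X ^ 20 = 3 * r ^ M.+1 * X ^ 20 by field; lra.
  have H := pow_geom_bound r M 21 r01.
  have HMX : X <= INR M * (1 - r).
    apply: (Rmult_le_reg_r (X ^ 10)) => //; rewrite Rmult_assoc HX Rmult_1_r; exact: HM.
  have H' : X ^ 21 * r ^ M <= INR (Factorial.fact 21).
    apply: Rle_trans H; apply: Rmult_le_compat_r; first by apply: pow_le; lra.
    by apply: pow_incr; lra.
  have rM : 0 < r ^ M by apply: pow_lt; lra.
  have rS : r ^ M.+1 <= r ^ M by rewrite /=; nra.
  apply: (Rmult_le_reg_r X) => //.
  have -> : 3 * r ^ M.+1 * X ^ 20 * X = 3 * (X ^ 21 * r ^ M.+1).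
    have -> : X ^ 21 = X ^ 20 * X by rewrite -[X in _ = _ * X]pow_1 -pow_add.
    ring.
  have : X ^ 21 * r ^ M.+1 <= X ^ 21 * r ^ M by apply: Rmult_le_compat_l => //; apply: pow_le; lra.
  lra.
have : 4 ^ 7 * X <= X ^ 8 by rewrite E8; nra.
lra.
Qed.

(** The scale is [X = (1 - r) ^ (- 1 / 10)].  As [V >= X ^ 30 / 400], the window
    [t0 = X / sqrt V] keeps the phase of order [X ^ 11 * V * t0 ^ 3 <= 20 / X]
    small, and still [V * t0 ^ 2 = X ^ 2] produces the decay [exp (- X)] outside
    it; [V] is at most a power of [X], so this decay beats
    [V ^ (3 / 2)]. *)
Lemma saddle_point_positive (s : nat -> R) (A : nat) (B : R) :
  s 0%nat = 0 -> (forall k, INR k <= s k) -> (forall k, s k <= B * INR k ^ A) -> 0 <= B ->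
  exists X0, 4 <= X0 /\ forall (X r : R) (M : nat) (n : Z) (W : R -> R),
    X0 <= X -> 0 < r < 1 -> (1 - r) * X ^ 10 = 1 -> X ^ 11 <= INR M ->
    sum_f_R0 (fun k => s k * r ^ k) M = IZR n ->
    (forall t, continuous W t) -> (forall t, 1 - cos t <= W t <= 4) ->
    0 < RInt (fun t => wave (fun k => s k * r ^ k) M n t * W t) 0 PI.
Proof.
move=> s0 s_ge s_le B_ge0.
set C1 := B * INR (Factorial.fact (11 * (A + 4))).
set c2 := 2 * (B * INR (Factorial.fact (A + 1 + 2))).
set q := (10 * (A + 1 + 2) * 2)%nat.
set c3 := 4096 * (c2 ^ 2 * INR (Factorial.fact q.+1)).
have C1_ge0 : 0 <= C1 by apply: Rmult_le_pos => //; exact: pos_INR.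
have c3_ge0 : 0 <= c3.
  apply: Rmult_le_pos; first by lra.
  by apply: Rmult_le_pos; [exact: pow2_ge_0 | exact: pos_INR].
have f21 : 0 < INR (Factorial.fact 21) by exact: INR_fact_lt_0.
exists (81 + 2 * C1 + 3 * INR (Factorial.fact 21) + c3); split; first by lra.
move=> X r M n W HX0 r01 HX HM Hn Wc HW.
set b := fun k => s k * r ^ k.
have b0 : b 0%nat = 0 by rewrite /b s0 Rmult_0_l.
have p_ge0 k : 0 <= r ^ k by apply: pow_le; lra.
have b_ge0 k : 0 <= b k.
  by apply: Rmult_le_pos => //; exact: Rle_trans (pos_INR k) (s_ge k).
have X_gt0 : 0 < X by lra.
have P11 : 0 < X ^ 11 by exact: pow_lt.
have X10 : X <= X ^ 10 by rewrite -{1}(pow_1 X); apply: Rle_pow; [lra | lia].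
have X11 : X ^ 10 <= X ^ 11 by apply: Rle_pow; [lra | lia].
set V := sum_f_R0 (fun k => INR k * b k) M.
have V_ge : X ^ 30 / 400 <= V.
  have -> : X ^ 30 = (X ^ 10) ^ 3 by rewrite -pow_mult.
  by apply: second_moment_ge => //; lra.
have V_le : V <= c2 * X ^ (10 * (A + 1 + 2)).
  have := moment_le s A 1 B r (X ^ 10) M s0 s_le B_ge0 r01 HX.
  rewrite -pow_mult.
  have -> : sum_f_R0 (fun k => INR k ^ 1 * (s k * r ^ k)) M = V.
    by apply: PartSum.sum_eq => k _; rewrite pow_1.
  by rewrite multE /c2; lra.
set kappa := sum_f_R0 (fun k => INR k ^ 2 * b k) M.
have tail k : X ^ 11 <= INR k -> INR k ^ 2 * b k <= C1 * / INR k ^ 2.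
  by move=> Hk; apply: (tail_term s A B r X k).
have isq_ge0 k : 0 <= / INR k ^ 2.
  case: k => [|k]; first by rewrite /= Rmult_0_l Rinv_0; lra.
  by apply: Rlt_le; apply: Rinv_0_lt_compat; apply: pow_lt; apply: lt_0_INR; lia.
have isq_sum := sum_inv_sq M.
(* Terms with [k <= X ^ 11] are compared with [V]; the others fall under [tail]. *)
have kappa_le : kappa <= X ^ 11 * V + 2 * C1.
  apply: (Rle_trans _ (X ^ 11 * V + C1 * sum_f_R0 (fun k => / INR k ^ 2) M)); last by nra.
  rewrite /V -sum_linear; apply: sum_Rle => k _.
  have Hk := pos_INR k; have Hb := b_ge0 k; have Hi := isq_ge0 k.
  have H0 : 0 <= C1 * / INR k ^ 2 by exact: Rmult_le_pos.
  have Hkb : 0 <= INR k * b k by exact: Rmult_le_pos.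
  case: (Rle_lt_dec (X ^ 11) (INR k)) => Hle.
    have := tail k Hle; have : 0 <= X ^ 11 * (INR k * b k) by apply: Rmult_le_pos; lra.
    lra.
  have -> : INR k ^ 2 * b k = INR k * (INR k * b k) by ring.
  have : INR k * (INR k * b k) <= X ^ 11 * (INR k * b k) by apply: Rmult_le_compat_r; lra.
  lra.
have X30 : 4 * X <= X ^ 30 / 400.
  have : 80 ^ 29 <= X ^ 29 by apply: pow_incr; lra.
  have : 1600 <= 80 ^ 29 by rewrite /=; lra.
  have -> : X ^ 30 = X * X ^ 29 by [].
  nra.
set sg := sqrt V.
have V_gt0 : 0 < V by lra.
have sg_gt0 : 0 < sg by exact: sqrt_lt_R0.
have sg2 : sg * sg = V by apply: sqrt_sqrt; lra.
have sg_ge : X ^ 15 / 20 <= sg.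
  have P15 : 0 < X ^ 15 by exact: pow_lt.
  have E30 : X ^ 30 = X ^ 15 * X ^ 15 by rewrite -pow_add.
  move: P15 V_ge; rewrite E30; set p := X ^ 15 => P15 HV; nra.
have sg_ge1 : 1 <= sg.
  apply: Rle_trans sg_ge.
  have -> : X ^ 15 = X * X ^ 14 by [].
  have : 1 <= X ^ 14 by apply: pow_R1_Rle; lra.
  nra.
have isg : 0 < / sg by exact: Rinv_0_lt_compat.
apply: (wave_integral_pos b M n V (X / sg) (/ sg) X W) => //.
- move=> t Ht.
  have := phase_bound b M (IZR n) t b_ge0 b0 Hn (proj1 Ht); rewrite -/kappa => H.
  apply: Rle_trans H _.
  have kappa_ge0 : 0 <= kappa by apply: cond_pos_sum => k; apply: Rmult_le_pos => //; exact: pow2_ge_0.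
  have Ht3 : t ^ 3 <= (X / sg) ^ 3 by apply: pow_incr.
  have HV1 : 2 * C1 <= X ^ 11 * V by nra.
  apply: (Rle_trans _ (2 * (2 * (X ^ 11 * V)) * (X / sg) ^ 3)).
    apply: Rmult_le_compat; [lra | by apply: pow_le; lra | lra | exact: Ht3].
  have -> : 2 * (2 * (X ^ 11 * V)) * (X / sg) ^ 3 = 4 * X ^ 14 / sg.
    rewrite -sg2; have -> : X ^ 14 = X ^ 11 * X ^ 3 by rewrite -pow_add.
    by field; lra.
  apply: (Rmult_le_reg_r sg) => //.
  have -> : 4 * X ^ 14 / sg * sg = 4 * X ^ 14 by field; lra.
  have P14 : 0 < X ^ 14 by exact: pow_lt.
  have E15 : X ^ 15 = X * X ^ 14 by [].
  nra.
- move=> t Ht; rewrite cos_gap_sum.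
  have t_ge0 : 0 <= t by have := Rdiv_lt_0_compat _ _ X_gt0 sg_gt0; lra.
  have quot_pos k : 0 <= b k / INR k.
    case: k => [|k]; first by rewrite b0 /Rdiv Rmult_0_l; lra.
    by apply: Rdiv_le_0_compat => //; apply: lt_0_INR; lia.
  case: (Rle_lt_dec t (/ X ^ 11)) => Htt; last first.
    apply: Rle_trans (geom_cos_gap_ge r X t M r01 HX _ _ HM _) _; try lra.
    apply: sum_Rle => -[|k] _; first by rewrite /= Rmult_0_l cos_0 Rminus_diag !Rmult_0_r; lra.
    apply: Rmult_le_compat_r; first by have := COS_bound (INR k.+1 * t); lra.
    have Hk : 0 < INR k.+1 by apply: lt_0_INR; lia.
    apply: (Rmult_le_reg_r (INR k.+1)) => //; rewrite (INR_div_mul b k.+1 b0) /b Rmult_comm.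
    by apply: Rmult_le_compat_r.
  (* For [t <= 1 / X ^ 11] all the terms with [k <= X ^ 11] are in the quadratic range of [cos]. *)
  set R0 := sum_f_R0 _ M.
  have H : t ^ 2 / 8 * V <= R0 + t ^ 2 / 8 * (2 * C1).
    have H2 := pow2_ge_0 t.
    have HtC : 0 <= t ^ 2 / 8 * C1 by apply: Rmult_le_pos; lra.
    apply: (Rle_trans _ (1 * R0 + (t ^ 2 / 8 * C1) * sum_f_R0 (fun k => / INR k ^ 2) M)); last first.
      by have := Rmult_le_compat_l _ _ _ HtC isq_sum; lra.
    rewrite /R0 -sum_linear /V scal_sum; apply: sum_Rle => k _.
    have Hk := pos_INR k; have Hb := b_ge0 k; have Hi := isq_ge0 k.
    have Hc : 0 <= b k / INR k * (1 - cos (INR k * t)).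
      by apply: Rmult_le_pos => //; have := COS_bound (INR k * t); lra.
    have HC : 0 <= C1 * / INR k ^ 2 by exact: Rmult_le_pos.
    case: (Rle_lt_dec (X ^ 11) (INR k)) => Hle.
      have H1 : 1 <= INR k by lra.
      have : INR k * b k <= INR k ^ 2 * b k by apply: Rmult_le_compat_r => //; rewrite /=; nra.
      have := tail k Hle; nra.
    have Hkt : 0 <= INR k * t <= 1.
      split; first exact: Rmult_le_pos.
      apply: (Rle_trans _ (X ^ 11 * / X ^ 11)); first by apply: Rmult_le_compat; lra.
      by rewrite Rinv_r; lra.
    have := Rmult_le_compat_l _ _ _ (quot_pos k) (one_sub_cos_ge _ Hkt).
    have -> : b k / INR k * ((INR k * t) ^ 2 / 8) = INR k * b k * (t ^ 2 / 8).
      by rewrite -{2}(INR_div_mul b k b0); move: (b k / INR k) => z; field.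
    have : 0 <= t ^ 2 / 8 * C1 * / INR k ^ 2 by rewrite Rmult_assoc; apply: Rmult_le_pos; lra.
    move: (t ^ 2 / 8 * C1 * _) (INR k * b k * _) (b k / INR k * (1 - _)) => u v w; lra.
  have Ht2 : (X / sg) ^ 2 <= t ^ 2.
    by apply: pow_incr; split; [apply: Rlt_le; apply: Rdiv_lt_0_compat; lra | lra].
  have E : (X / sg) ^ 2 * V = X ^ 2 by rewrite -sg2; field; lra.
  have : X ^ 2 <= t ^ 2 * V by rewrite -E; apply: Rmult_le_compat_r; lra.
  have : t ^ 2 * (4 * C1) <= t ^ 2 * V by apply: Rmult_le_compat_l; [exact: pow2_ge_0 | lra].
  rewrite /= in H *; nra.
- by move=> t; exact: cos_gap_le.
- split=> //; rewrite /Rdiv -{1}(Rmult_1_l (/ sg)); apply: Rmult_le_compat_r; lra.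
- by rewrite -Rinv_1; apply: Rinv_le_contravar; lra.
- by rewrite -sg2; apply: Req_le; field; lra.
apply: (Rmult_lt_reg_r (sg ^ 3)); first exact: pow_lt.
have -> : (/ sg) ^ 3 * sg ^ 3 = 1 by field; lra.
have sg3 : sg ^ 3 <= V ^ 2.
  have -> : V ^ 2 = sg ^ 3 * sg by rewrite -sg2; ring.
  have : 0 < sg ^ 3 by exact: pow_lt.
  nra.
have V2 : V ^ 2 <= c2 ^ 2 * X ^ q.
  rewrite /q pow_mult -Rpow_mult_distr; apply: pow_incr; lra.
have Hexp := pow_exp_bound X q.+1 ltac:(lra).
have He := exp_pos (- X).
apply: (Rle_lt_trans _ (4096 * exp (- X) * (c2 ^ 2 * X ^ q))).
  by apply: Rmult_le_compat_l; lra.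
apply: (Rmult_lt_reg_r X) => //.
have -> : 4096 * exp (- X) * (c2 ^ 2 * X ^ q) * X = 4096 * (c2 ^ 2 * (X ^ q.+1 * exp (- X))).
  by rewrite /=; ring.
have : c2 ^ 2 * (X ^ q.+1 * exp (- X)) <= c2 ^ 2 * INR (Factorial.fact q.+1).
  by apply: Rmult_le_compat_l => //; exact: pow2_ge_0.
rewrite -/c3 in c3_ge0; have : c3 < X by lra.
rewrite /c3; lra.
Qed.

(** * Eventual log-concavity from a convolution recurrence *)

(** The intermediate value theorem on [[0, 1]]: the truncation at [n + 1] makes the
    value at [1] at least [s (n + 1) > n]. *)
Lemma exists_saddle_radius (s : nat -> R) (n : nat) :
  s 0%nat = 0 -> (forall k, INR k <= s k) -> (0 < n)%coq_nat ->
  exists r, 0 < r < 1 /\ sum_f_R0 (fun k => s k * r ^ k) n.+1 = INR n.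
Proof.
move=> s0 s_ge n_gt0.
have n_pos : 0 < INR n by apply: lt_0_INR.
have at0 m : sum_f_R0 (fun k => s k * 0 ^ k) m = 0.
  by elim: m => [|m IH]; rewrite ?tech5 ?IH /= ?s0; ring.
have at1 : INR n + 1 <= sum_f_R0 (fun k => s k * 1 ^ k) n.+1.
  rewrite tech5 pow1 Rmult_1_r -S_INR.
  have : 0 <= sum_f_R0 (fun k => s k * 1 ^ k) n.
    by apply: cond_pos_sum => k; rewrite pow1 Rmult_1_r; exact: Rle_trans (pos_INR k) (s_ge k).
  have := s_ge n.+1; lra.
set f := fun r => sum_f_R0 (fun k => s k * r ^ k) n.+1 - INR n.
have f_cont : continuity f.
  apply: continuity_minus; last by apply: continuity_const.
  exact: continuity_finite_sum.
have [r [[r0 r1] fr]] := IVT f 0 1 f_cont Rlt_0_1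
  ltac:(by rewrite /f at0; lra) ltac:(by rewrite /f; lra).
exists r; rewrite /f in fr; split; last by lra.
split.
  by case: r0 => // E; move: fr; rewrite -E at0; lra.
by case: r1 => // E; move: fr; rewrite E; lra.
Qed.

(** The scale [X] tends to infinity with [n], because [n] is a moment, bounded by a
    power of [X].  Positivity is applied twice: with the constant weight to see
    that [fourier b M 0 > 0], then with [2 (1 - cos t)] for the inequality
    [2 N(n) r^n > N(n+1) r^(n+1) + N(n-1) r^(n-1)]. *)
Theorem eventually_log_concave (s N : nat -> R) (A : nat) (B : R) :
  s 0%nat = 0 -> (forall k, INR k <= s k) -> (forall k, s k <= B * INR k ^ A) ->
  N 0%nat = 1 -> (forall n, 0 <= N n) ->
  (forall n, INR n * N n = sum_f_R0 (fun k => s k * N (n - k)%nat) n) ->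
  exists n0 : nat, forall n, (n0 <= n)%nat -> N n.+1 * N n.-1 <= N n ^ 2.
Proof.
move=> s0 s_ge s_le N0 N_ge0 N_rec.
have B_ge0 : 0 <= B by have := s_ge 1%nat; have := s_le 1%nat; rewrite /= pow1; lra.
have s_ge0 k : 0 <= s k by exact: Rle_trans (pos_INR k) (s_ge k).
have [X0 [X0_ge4 positive]] := saddle_point_positive s A B s0 s_ge s_le B_ge0.
set c := 2 * (B * INR (Factorial.fact (A + 0 + 2)) * (X0 ^ 10) ^ (A + 0 + 2)).
have [n1 Hn1] : exists n1 : nat, c < INR n1.
  have [m [_ Hm]] := nfloor_ex (Rmax 0 c) (Rmax_l 0 c).
  by exists m.+1; rewrite S_INR; have := Rmax_r 0 c; lra.
exists n1.+1 => n Hn.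
have n_gt0 : (0 < n)%coq_nat by lia.
have c_lt : c < INR n by apply: Rlt_le_trans Hn1 (le_INR _ _ _); lia.
have [r [r01 Hr]] := exists_saddle_radius s n s0 s_ge n_gt0.
set M := n.+1 in Hr; set b := fun k => s k * r ^ k in Hr.
have y_gt0 : 0 < 1 - r by lra.
set X := Rpower (1 - r) (- / 10).
have X_gt0 : 0 < X by exact: exp_pos.
have HX : (1 - r) * X ^ 10 = 1.
  rewrite /X -Rpower_pow; last by exact: exp_pos.
  rewrite Rpower_mult -{1}(Rpower_1 (1 - r)) // -Rpower_plus.
  have -> : 1 + - / 10 * INR 10 = 0 by rewrite /=; field.
  by rewrite Rpower_O.
have X_ge : X0 <= X.
  case: (Rle_lt_dec X0 X) => // /Rlt_le HXX.
  have := moment_le s A 0 B r (X ^ 10) M s0 s_le B_ge0 r01 HX.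
  have -> : sum_f_R0 (fun k => INR k ^ 0 * (s k * r ^ k)) M = INR n.
    by rewrite -Hr; apply: PartSum.sum_eq => k _; rewrite /= Rmult_1_l.
  have P : (X ^ 10) ^ (A + 0 + 2) <= (X0 ^ 10) ^ (A + 0 + 2).
    by apply: pow_incr; split; [apply: pow_le; lra | apply: pow_incr; lra].
  have := Rmult_le_compat_l (B * INR (Factorial.fact (A + 0 + 2))) _ _
            (Rmult_le_pos _ _ B_ge0 (pos_INR _)) P.
  by rewrite /c in c_lt; lra.
have X9 : 64 <= X ^ 9.
  have := pow_incr 4 X 9 ltac:(lra).
  have : 64 <= 4 ^ 9 by rewrite /=; lra.
  lra.
have X10 : X <= X ^ 10 by rewrite -{1}(pow_1 X); apply: Rle_pow; [lra | lia].
have HM : X ^ 11 <= INR M.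
  have := first_moment_ge s r (X ^ 10) M s_ge r01 HX ltac:(lra).
  rewrite -/b Hr => /(_ ltac:(by rewrite /M S_INR; lra)).
  have -> : (X ^ 10) ^ 2 = X ^ 11 * X ^ 9 by rewrite -pow_mult -pow_add.
  have : 0 < X ^ 11 by exact: pow_lt.
  rewrite /M S_INR; nra.
have b0 : b 0%nat = 0 by rewrite /b s0 Rmult_0_l.
rewrite INR_IZR_INZ in Hr.
have coef j := fourier_coef s N r M s0 s_ge0 (proj1 r01) N0 N_rec j; rewrite -/b in coef.
have C_pos : 0 < fourier b M 0.
  have P2 := positive X r M (Z.of_nat n) (fun _ => 2) X_ge r01 HX HM Hr
    (fun t => continuous_const _ _) ltac:(by move=> t; have := COS_bound t; lra).
  have E : RInt (fun t => wave b M (Z.of_nat n) t * 2) 0 PI = fourier b M (Z.of_nat n) * 2.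
    apply: is_RInt_unique.
    apply: (is_RInt_ext (fun t => scal 2 (wave b M (Z.of_nat n) t))).
      by move=> t _; rewrite /Hierarchy.scal /= /Hierarchy.mult /= Rmult_comm.
    rewrite Rmult_comm; apply: (is_RInt_scal (V := R_NormedModule)).
    by apply: RInt_correct; exact: ex_RInt_wave.
  rewrite -/b E coef in P2; last by rewrite /M; lia.
  have rn : 0 <= N n * r ^ n by apply: Rmult_le_pos => //; apply: pow_le; lra.
  nra.
have W_cont t : continuous (fun t => 2 * (1 - cos t)) t.
  by apply: ex_derive_continuous; auto_derive.
have := positive X r M (Z.of_nat n) _ X_ge r01 HX HM Hr W_cont
  ltac:(by move=> t; have := COS_bound t; lra).
rewrite -/b fourier_second_difference //.
have -> : Z.add (Z.of_nat n) 1 = Z.of_nat n.+1 by lia.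
have -> : Z.sub (Z.of_nat n) 1 = Z.of_nat n.-1 by lia.
rewrite !coef; try (rewrite /M; lia).
have rp : 0 < r ^ n.-1 by apply: pow_lt; lra.
have -> : r ^ n = r * r ^ n.-1 by rewrite -[in LHS](Nat.succ_pred_pos n n_gt0).
have -> : r ^ n.+1 = r * (r * r ^ n.-1) by rewrite -[in LHS](Nat.succ_pred_pos n n_gt0).
set p := r ^ n.-1 in rp *; set F := fourier b M 0 in C_pos *.
have Na := N_ge0 n.+1; have Nb := N_ge0 n.-1; have Nc := N_ge0 n.
set a := N n.+1 in Na *; set d := N n.-1 in Nb *; set e := N n in Nc *.
have -> : 2 * (F * (e * (r * p))) - F * (a * (r * (r * p))) - F * (d * p)
  = (F * p) * (2 * (e * r) - (a * r ^ 2 + d)) by ring.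
have Fp : 0 < F * p by exact: Rmult_lt_0_compat.
move=> H; have {H} : a * r ^ 2 + d < 2 * (e * r).
  by apply: Rminus_gt_0_lt; apply: (Rmult_lt_reg_l (F * p)); rewrite ?Rmult_0_r.
(* Arithmetic-geometric mean: [ar + d < 2 e r] gives [ar * d <= (e r) ^ 2]. *)
set ar := a * r ^ 2; have ar_ge0 : 0 <= ar by apply: Rmult_le_pos => //; exact: pow2_ge_0.
move=> H; apply: (Rmult_le_reg_r (r ^ 2)); first by apply: pow_lt; lra.
have -> : e ^ 2 * r ^ 2 = (e * r) ^ 2 by ring.
have -> : a * d * r ^ 2 = ar * d by rewrite /ar; ring.
have := pow_incr ((ar + d) / 2) (e * r) 2 ltac:(lra).
have := pow2_ge_0 (ar - d); rewrite /=; lra.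
Qed.

End Analysis.

Set Implicit Arguments.
Unset Strict Implicit.

(** * Orbit decomposition of commuting tuples *)

Section Combinatorics.

Definition comm_tuples (l : nat) (T : finType) : {set {ffun 'I_l -> {perm T}}} :=
  [set p : {ffun 'I_l -> {perm T}} | [forall j, forall k, (p j * p k == p k * p j)%g]].

Definition stable (l : nat) (T : finType) (p : {ffun 'I_l -> {perm T}}) (S : {set T}) : bool :=
  [forall j, forall x in S, p j x \in S].

(** A minimal nonempty stable set.  Permutations of a finite set map a stable set
    onto itself, so these are the orbits of the generated group, described
    without mentioning that group. *)
Definition is_orbit (l : nat) (T : finType) (p : {ffun 'I_l -> {perm T}}) (A : {set T}) : bool :=
  stable p A && [forall S : {set T}, [&& S \subset A, S != set0 & stable p S] ==> (S == A)].

Definition trans_tuples (l : nat) (T : finType) : {set {ffun 'I_l -> {perm T}}} :=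
  [set p in comm_tuples l T | is_orbit p setT].

Lemma stableP (l : nat) (T : finType) (p : {ffun 'I_l -> {perm T}}) (S : {set T}) :
  reflect (forall j x, x \in S -> p j x \in S) (stable p S).
Proof. by apply: (iffP forallP) => H j; [apply/forall_inP: (H j) | apply/forall_inP; exact: H]. Qed.

Lemma is_orbitP (l : nat) (T : finType) (p : {ffun 'I_l -> {perm T}}) (A : {set T}) :
  reflect (stable p A /\ forall S : {set T}, S \subset A -> S != set0 -> stable p S -> S = A)
    (is_orbit p A).
Proof.
apply: (iffP andP) => -[stA H]; split=> //.
  by move=> S sSA S0 stS; apply/eqP/(implyP (forallP H S)); rewrite sSA S0 stS.
by apply/forallP => S; apply/implyP => /and3P[sSA S0 stS]; apply/eqP; exact: H.
Qed.

Lemma perm_stable (T : finType) (s : {perm T}) (S : {set T}) :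
  (forall x, x \in S -> s x \in S) -> forall x, (s x \in S) = (x \in S).
Proof.
move=> st x; apply/idP/idP => [sxS|]; last exact: st.
have E : s @: S = S.
  apply/eqP; rewrite eqEcard card_imset ?leqnn ?andbT; last exact: perm_inj.
  by apply/subsetP => _ /imsetP[y yS ->]; exact: st.
by move: sxS; rewrite -{1}E => /imsetP[y yS /perm_inj->].
Qed.

Lemma stable_setD (l : nat) (T : finType) (p : {ffun 'I_l -> {perm T}}) (A S : {set T}) :
  stable p A -> stable p S -> stable p (A :\: S).
Proof.
move=> /stableP stA /stableP stS; apply/stableP => j x; rewrite !inE.
by rewrite (perm_stable (stS j)) => /andP[-> /stA ->].
Qed.

(** Take a smallest stable set [A] containing [x]; a stable subset [S] avoiding [x]
    could be removed from it. *)
Lemma orbit_exists (l : nat) (T : finType) (p : {ffun 'I_l -> {perm T}}) (x : T) :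
  exists2 A : {set T}, x \in A & is_orbit p A.
Proof.
pose P (S : {set T}) := (x \in S) && stable p S.
have PT : P setT by rewrite /P inE; apply/stableP => j y; rewrite !inE.
case: (arg_minnP (fun S : {set T} => #|S|) PT) => A /andP[xA stA] minA.
exists A => //; apply/is_orbitP; split=> // S sSA S0 stS.
case: (boolP (x \in S)) => xS.
  by have := minA S; rewrite /P xS stS => /(_ isT) leAS; apply/eqP; rewrite eqEcard sSA leAS.
have := minA (A :\: S); rewrite /P !inE xS xA stable_setD //= => /(_ isT) leA.
have /eqP E : A :\: S == A by rewrite eqEcard subsetDl.
case/set0Pn: S0 => y yS.
by have := subsetP sSA y yS; rewrite -E inE yS.
Qed.

Lemma orbit_unique (l : nat) (T : finType) (p : {ffun 'I_l -> {perm T}}) (x : T) (A B : {set T}) :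
  x \in A -> x \in B -> is_orbit p A -> is_orbit p B -> A = B.
Proof.
move=> xA xB /is_orbitP[/stableP stA minA] /is_orbitP[/stableP stB minB].
have I0 : A :&: B != set0 by apply/set0Pn; exists x; rewrite inE xA.
have stI : stable p (A :&: B).
  by apply/stableP => j y; rewrite !inE => /andP[/stA-> /stB->].
by rewrite -(minA _ (subsetIl A B) I0 stI) (minB _ (subsetIr A B) I0 stI).
Qed.

(** A bijection [phi] from [T1 + T2] onto [T] identifies the pairs of permutations of
    [T1] and [T2] with the permutations of [T] that preserve the image of [T1]. *)
Section Glue.

Variables (T1 T2 T : finType) (phi : T1 + T2 -> T) (psi : T -> T1 + T2).
Hypotheses (phiK : cancel phi psi) (psiK : cancel psi phi).

Definition glue_fun (s1 : {perm T1}) (s2 : {perm T2}) (x : T) : T :=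
  phi match psi x with inl a => inl (s1 a) | inr b => inr (s2 b) end.

Lemma glue_inj s1 s2 : injective (glue_fun s1 s2).
Proof.
move=> x y /(can_inj phiK); rewrite -{2}(psiK x) -{2}(psiK y).
by case: (psi x) => a; case: (psi y) => b // [] /perm_inj->.
Qed.

Definition glue s1 s2 : {perm T} := perm (@glue_inj s1 s2).

Lemma glueL s1 s2 a : glue s1 s2 (phi (inl a)) = phi (inl (s1 a)).
Proof. by rewrite permE /glue_fun phiK. Qed.

Lemma glueR s1 s2 b : glue s1 s2 (phi (inr b)) = phi (inr (s2 b)).
Proof. by rewrite permE /glue_fun phiK. Qed.

Lemma glueM s1 s2 t1 t2 : glue (s1 * t1) (s2 * t2) = (glue s1 s2 * glue t1 t2)%g.
Proof.
by apply/permP => x; rewrite permM -(psiK x); case: (psi x) => a; rewrite ?glueL ?glueR permM.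
Qed.

Lemma glue_eq s1 s2 t1 t2 : (glue s1 s2 == glue t1 t2) = (s1 == t1) && (s2 == t2).
Proof.
apply/eqP/andP => [E|[/eqP-> /eqP->] //]; split; apply/eqP/permP => a.
  by move/permP/(_ (phi (inl a))): E; rewrite !glueL => /(can_inj phiK)[].
by move/permP/(_ (phi (inr a))): E; rewrite !glueR => /(can_inj phiK)[].
Qed.

Definition left_part : {set T} := [set phi (inl a) | a in T1].

Lemma mem_left_part u : (phi u \in left_part) = if u is inl _ then true else false.
Proof.
apply/imsetP/idP => [[a _ /(can_inj phiK)->] //|].
by case: u => // a _; exists a.
Qed.

Lemma glue_surj (s : {perm T}) :
  (forall x, x \in left_part -> s x \in left_part) -> exists s12, s = glue s12.1 s12.2.
Proof.
move=> st; have st' := perm_stable st.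
pose f1 a := if psi (s (phi (inl a))) is inl a' then a' else a.
pose f2 b := if psi (s (phi (inr b))) is inr b' then b' else b.
have E1 a : s (phi (inl a)) = phi (inl (f1 a)).
  have := st' (phi (inl a)); rewrite mem_left_part -(psiK (s _)) mem_left_part /f1.
  by case: (psi _).
have E2 b : s (phi (inr b)) = phi (inr (f2 b)).
  have := st' (phi (inr b)); rewrite mem_left_part -(psiK (s _)) mem_left_part /f2.
  by case: (psi _).
have inj1 : injective f1.
  by move=> a b E; have := E1 a; rewrite E -E1 => /perm_inj/(can_inj phiK)[].
have inj2 : injective f2.
  by move=> a b E; have := E2 a; rewrite E -E2 => /perm_inj/(can_inj phiK)[].
exists (perm inj1, perm inj2); apply/permP => x; rewrite -(psiK x).
by case: (psi x) => a; rewrite ?glueL ?glueR /= permE.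
Qed.

Variable l : nat.

Definition glue_tuple (q : {ffun 'I_l -> {perm T1}} * {ffun 'I_l -> {perm T2}}) :
  {ffun 'I_l -> {perm T}} := [ffun j => glue (q.1 j) (q.2 j)].

Lemma glue_tuple_inj : injective glue_tuple.
Proof.
move=> [q1 q2] [r1 r2] /ffunP E.
have H j : q1 j = r1 j /\ q2 j = r2 j.
  by have := E j; rewrite !ffunE /= => /eqP; rewrite glue_eq => /andP[/eqP-> /eqP->].
by congr pair; apply/ffunP => j; case: (H j).
Qed.

Lemma glue_tuple_comm q :
  (glue_tuple q \in comm_tuples l T) = (q.1 \in comm_tuples l T1) && (q.2 \in comm_tuples l T2).
Proof.
rewrite !inE; apply/forallP/andP => [H|[/forallP H1 /forallP H2] j].
  split; apply/forallP => j; apply/forallP => k; have := forallP (H j) k;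
  by rewrite !ffunE -!glueM glue_eq => /andP[].
apply/forallP => k; rewrite !ffunE -!glueM glue_eq.
by rewrite (forallP (H1 j) k) (forallP (H2 j) k).
Qed.

Definition lift_set (S : {set T1}) : {set T} := [set phi (inl a) | a in S].

Lemma lift_set_inj : injective lift_set.
Proof. by apply: imset_inj => a b /(can_inj phiK)[]. Qed.

Lemma mem_lift_set S a : (phi (inl a) \in lift_set S) = (a \in S).
Proof. by rewrite mem_imset // => b c /(can_inj phiK)[]. Qed.

Lemma stable_lift_set q S : stable (glue_tuple q) (lift_set S) = stable q.1 S.
Proof.
apply/stableP/stableP => st j.
  by move=> a aS; have := st j (phi (inl a)); rewrite ffunE glueL !mem_lift_set; exact.
by move=> _ /imsetP[a aS ->]; rewrite ffunE glueL mem_lift_set; exact: st.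
Qed.

Lemma glue_tuple_orbit q : is_orbit (glue_tuple q) left_part = is_orbit q.1 setT.
Proof.
have E : left_part = lift_set setT by apply/setP => x; apply/imsetP/imsetP => -[a _ ->]; exists a.
rewrite E; apply/is_orbitP/is_orbitP => -[st H]; split.
- by rewrite -(stable_lift_set q).
- move=> S sS S0 stS; apply: lift_set_inj; apply: H.
  + by apply: imsetS.
  + by case/set0Pn: S0 => a aS; apply/set0Pn; exists (phi (inl a)); rewrite mem_lift_set.
  + by rewrite stable_lift_set.
- by rewrite stable_lift_set.
move=> S sS S0 stS.
have ES : S = lift_set [set a | phi (inl a) \in S].
  apply/setP => x; apply/idP/imsetP => [xS|[a]]; last by rewrite inE => aS ->.
  by have /imsetP[a _ Ex] := subsetP sS x xS; exists a; rewrite // inE -Ex.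
rewrite ES; congr lift_set; apply: H => //.
  case/set0Pn: S0 => x xS; have /imsetP[a _ Ex] := subsetP sS x xS.
  by apply/set0Pn; exists a; rewrite inE -Ex.
by rewrite -(stable_lift_set q) -ES.
Qed.

Lemma card_orbit_left_part :
  #|[set p in comm_tuples l T | is_orbit p left_part]| = #|trans_tuples l T1| * #|comm_tuples l T2|.
Proof.
rewrite -cardsX -(card_imset _ glue_tuple_inj); apply: eq_card => p.
have memE q : (glue_tuple q \in [set p in comm_tuples l T | is_orbit p left_part])
            = (q \in setX (trans_tuples l T1) (comm_tuples l T2)).
  case: q => q1 q2; rewrite in_set in_setX.
  have -> : (q1 \in trans_tuples l T1) = (q1 \in comm_tuples l T1) && is_orbit q1 setT.
    by rewrite in_set.
  by rewrite glue_tuple_comm glue_tuple_orbit andbAC.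
apply/idP/imsetP => [|[q Hq ->]]; last by rewrite memE.
move=> Hp; have := Hp; rewrite inE => /andP[_ /andP[/stableP st _]].
have [g Eg] := fin_all_exists (fun j => glue_surj (st j)).
have Ep : p = glue_tuple ([ffun j => (g j).1], [ffun j => (g j).2]).
  by apply/ffunP => j; rewrite !ffunE Eg.
by exists ([ffun j => (g j).1], [ffun j => (g j).2]); rewrite // -memE -Ep.
Qed.

End Glue.

Lemma split_bijection (T : finType) (A : {set T}) :
  exists (phi : 'I_#|A| + 'I_#|~: A| -> T) (psi : T -> 'I_#|A| + 'I_#|~: A|),
    [/\ cancel phi psi, cancel psi phi & left_part phi = A].
Proof.
pose phi (u : 'I_#|A| + 'I_#|~: A|) : T :=
  match u with inl a => enum_val a | inr b => enum_val b end.
have phi_inj : injective phi.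
  move=> [a|a] [b|b] /=; first by move/enum_val_inj->.
  - by move=> E; have := enum_valP b; rewrite -E inE enum_valP.
  - by move=> E; have := enum_valP a; rewrite E inE enum_valP.
  by move/enum_val_inj->.
have [|psi K1 K2] := inj_card_bij phi_inj.
  by rewrite card_sum !card_ord cardsC.
exists phi, psi; split=> //; apply/setP => x; apply/imsetP/idP => [[a _ ->]|xA].
  exact: enum_valP.
by exists (enum_rank_in xA x); rewrite //= enum_rankK_in.
Qed.

Lemma card_comm_orbit (l : nat) (T : finType) (A : {set T}) :
  #|[set p in comm_tuples l T | is_orbit p A]|
  = #|trans_tuples l 'I_#|A| | * #|comm_tuples l 'I_(#|T| - #|A|)|.
Proof.
have [phi [psi [K1 K2 EA]]] := split_bijection A.
have EC : #|~: A| = #|T| - #|A| by rewrite -(cardsC A) addKn.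
by have := card_orbit_left_part K1 K2 l; rewrite EA EC.
Qed.

(** Double counting of pairs (commuting tuple, point): each point lies in exactly
    one orbit [A], and the tuple restricts to a transitive tuple on [A] and an
    arbitrary one on the complement.  The factor [k] is the number of points
    of [A]. *)
Lemma comm_tuples_rec (l n : nat) :
  n * #|comm_tuples l 'I_n|
  = \sum_(k < n.+1) 'C(n, k) * (k * #|trans_tuples l 'I_k|) * #|comm_tuples l 'I_(n - k)|.
Proof.
pose F (A : {set 'I_n}) := #|trans_tuples l 'I_#|A| | * #|comm_tuples l 'I_(n - #|A|)|.
transitivity (\sum_(x : 'I_n) \sum_(A : {set 'I_n} | x \in A) F A).
  have E x : #|comm_tuples l 'I_n| = \sum_(A : {set 'I_n} | x \in A) F A.
    transitivity (\sum_(A : {set 'I_n} | x \in A) #|[set p in comm_tuples l 'I_n | is_orbit p A]|).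
      under [RHS]eq_bigr => A _ do rewrite -sum1_card big_mkcond.
      rewrite exchange_big /= -sum1_card big_mkcond; apply: eq_bigr => p _.
      have memE A : (p \in [set q in comm_tuples l 'I_n | is_orbit q A])
                  = (p \in comm_tuples l 'I_n) && is_orbit p A by rewrite in_set.
      have [A xA pA] := orbit_exists p x.
      rewrite (bigD1 A xA) /= big1 => [|B /andP[xB nBA]]; rewrite memE.
        by rewrite pA andbT addn0.
      by case: ifP => // /andP[_ pB]; rewrite (orbit_unique xB xA pB pA) eqxx in nBA.
    by apply: eq_bigr => A _; rewrite card_comm_orbit card_ord.
  by rewrite (eq_bigr _ (fun x _ => esym (E x))) sum_nat_const card_ord.
rewrite (exchange_big_dep predT) //=.
have Hcard (A : {set 'I_n}) : #|A| < n.+1 by rewrite ltnS -[leqRHS]card_ord max_card.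
rewrite (partition_big (fun A => Ordinal (Hcard A)) predT) //=; apply: eq_bigr => k _.
rewrite (eq_bigr (fun=> k * (#|trans_tuples l 'I_k| * #|comm_tuples l 'I_(n - k)|))); last first.
  by move=> A /eqP <- /=; rewrite sum_nat_const.
rewrite sum_nat_const -mulnA; congr (_ * _); last by rewrite mulnA.
have := card_draws 'I_n k; rewrite card_ord => <-; rewrite -cardsE; apply: eq_card => A.
by rewrite !in_set.
Qed.

Local Open Scope group_scope.

(** * Regular abelian permutation groups *)

(** A transitive abelian group acts freely ([simply_transitive_free]), so
    commutativity and transitivity together are simple transitivity. *)
Definition simply_transitive (T : finType) (H : {group {perm T}}) : bool :=
  abelian H && [forall x : T, forall y : T, exists h in H, (h : {perm T}) x == y].

Lemma simply_transitiveP (T : finType) (H : {group {perm T}}) :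
  reflect (abelian H /\ forall x y : T, exists2 h : {perm T}, h \in H & h x = y)
    (simply_transitive H).
Proof.
apply: (iffP andP) => -[abH tr]; split=> //.
  by move=> x y; have /exists_inP[h hH /eqP] := forallP (forallP tr x) y; exists h.
apply/forallP => x; apply/forallP => y; have [h hH E] := tr x y.
by apply/exists_inP; exists h; rewrite ?E.
Qed.

Lemma abelian_perm_swap (T : finType) (H : {group {perm T}}) (g h : {perm T}) (x : T) :
  abelian H -> g \in H -> h \in H -> g (h x) = h (g x).
Proof. by move=> abH gH hH; rewrite -!permM (centsP abH g gH h hH). Qed.

(** If [g] and [h] agree at [x], they agree at [a x] for every [a] in the group,
    by commutativity, hence everywhere by transitivity. *)
Lemma simply_transitive_free (T : finType) (H : {group {perm T}}) (g h : {perm T}) (x : T) :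
  simply_transitive H -> g \in H -> h \in H -> g x = h x -> g = h.
Proof.
case/simply_transitiveP => abH tr gH hH E; apply/permP => y.
have [a aH <-] := tr x y.
by rewrite (abelian_perm_swap _ abH gH aH) E (abelian_perm_swap _ abH aH hH).
Qed.

Lemma card_simply_transitive (T : finType) (H : {group {perm T}}) (x : T) :
  simply_transitive H -> #|H| = #|T|.
Proof.
move=> stH; have [abH tr] := simply_transitiveP _ stH.
rewrite -(card_in_imset (f := fun h : {perm T} => h x)); last first.
  by move=> g h gH hH /=; exact: (simply_transitive_free stH gH hH).
apply: eq_card => y; rewrite [RHS]inE; apply/imsetP.
by have [h hH E] := tr x y; exists h.
Qed.

(** An isomorphism [f] from [H] to [K] is realised by the bijection sending [h x0] to
    [f h x0]. *)
Lemma simply_transitive_conj (T : finType) (H K : {group {perm T}}) (x0 : T) :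
  simply_transitive H -> simply_transitive K -> H \isog K ->
  exists s : {perm T}, K :=: H :^ s.
Proof.
move=> stH stK /isogP[f injf fH].
have [abH trH] := simply_transitiveP _ stH.
have [abK trK] := simply_transitiveP _ stK.
have fK h : h \in H -> f h \in K by move=> hH; rewrite -fH mem_morphim.
pose s0 y : T := (f (odflt 1 [pick h : {perm T} in H | h x0 == y])) x0.
have s0E h : h \in H -> s0 (h x0) = (f h) x0.
  move=> hH; rewrite /s0; case: pickP => [g /andP[gH /eqP E]|/(_ h)]; last by rewrite hH eqxx.
  by rewrite /= (simply_transitive_free stH gH hH E).
have s0_inj : injective s0.
  move=> y z; have [g gH <-] := trH x0 y; have [h hH <-] := trH x0 z.
  rewrite !s0E // => /(simply_transitive_free stK (fK g gH) (fK h hH)) E.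
  by rewrite (injmP injf g h gH hH E).
have fE h : h \in H -> f h = h ^ perm s0_inj.
  move=> hH; apply/permP => z.
  have [k kK <-] := trK x0 z.
  have : k \in f @* H by rewrite fH.
  case/morphimP => g _ gH ->.
  have Eg : perm s0_inj (g x0) = f g x0 by rewrite permE s0E.
  have Egh : perm s0_inj (h (g x0)) = f h (f g x0).
    by rewrite permE -permM s0E ?groupM // morphM // permM.
  by rewrite -Egh -Eg conjgE !permM permK.
exists (perm s0_inj); rewrite -fH; apply/setP => k; apply/morphimP/imsetP => [[h hD hH ->]|[h hH ->]].
  by exists h => //; exact: fE.
by exists h => //; exact/esym/fE.
Qed.

(** The groups isomorphic to [H] lie in one conjugacy class, whose size is the
    index of a normaliser containing [H] itself, of order [#|T|]. *)
Lemma card_isog_simply_transitive (T : finType) (H : {group {perm T}}) (x0 : T) :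
  simply_transitive H ->
  #|T| * #|[set K : {group {perm T}} | simply_transitive K & H \isog K]| <= #|T|`!.
Proof.
move=> stH; set C := [set K : {group _} | _ & _].
have le1 : #|C| <= #|(H :^: [set: {perm T}])|.
  rewrite -(card_imset _ (@group_inj _)) subset_leq_card //.
  apply/subsetP => _ /imsetP[K + ->]; rewrite inE => /andP[stK isoK].
  have [s ->] := simply_transitive_conj x0 stH stK isoK.
  by apply/imsetP; exists s; rewrite ?inE.
have leN : #|T| <= #|'N_[set: {perm T}](H)|.
  by rewrite -(card_simply_transitive x0 stH) subset_leq_card // setTI normG.
have <- : #|[set: {perm T}]| = #|T|`! by rewrite -card_Sym; apply: eq_card => s; rewrite !inE.
rewrite -(Lagrange (subsetIl [set: {perm T}]%G 'N(H))) -card_conjugates.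
exact: leq_mul.
Qed.

Lemma abelian_type_le (gT : finGroupType) (G : {group gT}) (i : nat) :
  abelian G -> nth 0 (abelian_type G) i <= #|G|.
Proof.
move=> abG; have [b defG <-] := abelian_structure abG.
case: (ltnP i (size b)) => Hi; last by rewrite nth_default ?size_map.
rewrite (nth_map 1) //; apply: dvdn_leq => //; apply: order_dvdG.
rewrite -(bigdprodWY defG) mem_gen //.
rewrite (big_nth 1) big_mkord; apply/bigcupP; exists (Ordinal Hi) => //.
exact: cycle_id.
Qed.

(** * Counting transitive commuting tuples *)

Definition gen_group (l : nat) (T : finType) (p : {ffun 'I_l -> {perm T}}) : {group {perm T}} :=
  <<[set p j | j : 'I_l]>>%G.

Lemma mem_gen_group (l : nat) (T : finType) (p : {ffun 'I_l -> {perm T}}) j : p j \in gen_group p.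
Proof. by rewrite mem_gen // imset_f. Qed.

Lemma comm_tuplesP (l : nat) (T : finType) (p : {ffun 'I_l -> {perm T}}) :
  reflect (forall j k, p j * p k = p k * p j) (p \in comm_tuples l T).
Proof.
rewrite in_set; apply: (iffP forallP) => H j; first by move=> k; apply/eqP/(forallP (H j)).
by apply/forallP => k; apply/eqP.
Qed.

Lemma gen_group_simply_transitive (l : nat) (T : finType) (p : {ffun 'I_l -> {perm T}}) :
  p \in trans_tuples l T -> simply_transitive (gen_group p).
Proof.
rewrite in_set => /andP[/comm_tuplesP comm /is_orbitP[_ tr]].
apply/simply_transitiveP; split.
  rewrite /= abelian_gen; apply/centsP => _ /imsetP[j _ ->] _ /imsetP[k _ ->].
  exact: comm.
move=> x y; pose S := [set (h : {perm T}) x | h in gen_group p].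
have xS : x \in S by apply/imsetP; exists 1; rewrite ?group1 ?perm1.
have : y \in S.
  rewrite (tr S) ?subsetT //; first by apply/set0Pn; exists x.
  apply/stableP => j _ /imsetP[h hH ->]; apply/imsetP; exists (h * p j).
    by rewrite groupM ?mem_gen_group.
  by rewrite permM.
by case/imsetP => h hH ->; exists h.
Qed.

Lemma size_abelian_type_gen_group (l : nat) (T : finType) (p : {ffun 'I_l -> {perm T}}) :
  p \in trans_tuples l T -> size (abelian_type (gen_group p)) <= l.
Proof.
move/gen_group_simply_transitive => /simply_transitiveP[abH _].
rewrite size_abelian_type // -grank_abelian //.
apply: leq_trans (grank_min _) _.
by rewrite -[leqRHS]card_ord; exact: leq_imset_card.
Qed.

Definition transitive_groups (l : nat) (T : finType) : {set {group {perm T}}} :=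
  [set H : {group {perm T}} | simply_transitive H & size (abelian_type H) <= l].

(** A tuple is a choice of [l] elements in the group it generates. *)
Lemma card_trans_tuples_le (l : nat) (T : finType) (x0 : T) :
  #|trans_tuples l T| <= #|transitive_groups l T| * #|T| ^ l.
Proof.
rewrite -sum1_card (partition_big (@gen_group l T) (mem (transitive_groups l T))) /=; last first.
  move=> p pT; rewrite inE gen_group_simply_transitive //.
  exact: size_abelian_type_gen_group.
rewrite -sum_nat_const; apply: leq_sum => H; rewrite inE => /andP[stH _].
rewrite sum1_card -(card_simply_transitive x0 stH) -[in leqRHS](card_ord l) -card_ffun_on.
apply: subset_leq_card; apply/subsetP => p /andP[_ /eqP <-].
by apply/ffun_onP => j; exact: mem_gen_group.
Qed.

(** The isomorphism type of such a group is its list of invariant factors: at most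
    [l] numbers, each at most [#|T|]. *)
Lemma card_transitive_groups_le (l : nat) (T : finType) (x0 : T) :
  #|T| * #|transitive_groups l T| <= l.+1 * #|T|.+1 ^ l * #|T|`!.
Proof.
pose enc (H : {group {perm T}}) : 'I_l.+1 * {ffun 'I_l -> 'I_#|T|.+1} :=
  (inord (size (abelian_type H)), [ffun i : 'I_l => inord (nth 0 (abelian_type H) i)]).
have encP H K : H \in transitive_groups l T -> K \in transitive_groups l T -> enc H = enc K ->
   H \isog K.
  rewrite !inE => /andP[stH szH] /andP[stK szK] [E1 /ffunP E2].
  have [abH _] := simply_transitiveP _ stH; have [abK _] := simply_transitiveP _ stK.
  rewrite eq_abelian_type_isog //; apply/eqP.
  have szE : size (abelian_type H) = size (abelian_type K).
    by move/(congr1 val): E1; rewrite /= !inordK.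
  (* [inord] loses nothing: sizes are at most [l], factors at most [#|T|]. *)
  apply: (@eq_from_nth _ 0) => // i Hi.
  have Hil : i < l by exact: leq_trans Hi szH.
  move: (E2 (Ordinal Hil)); rewrite !ffunE /= => /(congr1 val); rewrite /= !inordK //.
    by rewrite ltnS -(card_simply_transitive x0 stK) abelian_type_le.
  by rewrite ltnS -(card_simply_transitive x0 stH) abelian_type_le.
rewrite -sum1_card (partition_big enc predT) //= big_distrr /=.
have -> : (l.+1 * #|T|.+1 ^ l * #|T|`!
  = \sum_(e : 'I_l.+1 * {ffun 'I_l -> 'I_#|T|.+1}) #|T|`!)%N.
  by rewrite sum_nat_const card_prod card_ffun !card_ord.
apply: leq_sum => e _; rewrite sum1_card.
case: (pickP [pred H | (H \in transitive_groups l T) && (enc H == e)]) => [H /= /andP[HG /eqP He] | H0].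
  have stH : simply_transitive H by move: HG; rewrite inE => /andP[].
  apply: leq_trans (card_isog_simply_transitive x0 stH); rewrite leq_mul2l; apply/orP; right.
  apply: subset_leq_card; apply/subsetP => K /andP[KG /eqP Ke].
  by rewrite inE (encP H K HG KG) ?He ?Ke // andbT; move: KG; rewrite inE => /andP[].
by rewrite (eq_card0 H0) muln0.
Qed.

Lemma trans_tuples_upper (l k : nat) :
  k * #|trans_tuples l 'I_k| <= l.+1 * k.+1 ^ l * k ^ l * k`!.
Proof.
case: k => [|k]; first by rewrite mul0n.
have H1 := card_trans_tuples_le l (ord0 : 'I_k.+1).
have := card_transitive_groups_le l (ord0 : 'I_k.+1).
rewrite !card_ord in H1 * => H2.
apply: (@leq_trans (k.+1 * (#|transitive_groups l 'I_k.+1| * k.+1 ^ l))).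
  by rewrite leq_mul2l H1 orbT.
by rewrite mulnA -[leqRHS]mulnAC leq_mul2r H2 orbT.
Qed.

Definition rotation (k : nat) : {perm 'I_k} := perm (@ordS_inj k).

Lemma rotationX (k : nat) (i : nat) (x : 'I_k) : ((rotation k ^+ i) x : nat) = (x + i) %% k.
Proof.
elim: i => [|i IH]; first by rewrite expg0 perm1 addn0 modn_small.
by rewrite expgSr permM permE /= IH -addn1 modnDml addn1 addnS.
Qed.

Lemma rotation_trans (k : nat) (x y : 'I_k) : exists i, (rotation k ^+ i) x = y.
Proof.
exists (k - x + y); apply: val_inj; rewrite /= rotationX addnA subnKC ?modnDl ?modn_small //.
exact: ltnW.
Qed.

(** A permutation commuting with a transitive cycle is determined by the image of
    one point, so its centraliser has at most [k] elements. *)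
Lemma card_class_rotation (k : nat) : 0 < k -> k`! <= k * #|rotation k ^: [set: {perm 'I_k}]|.
Proof.
case: k => // k _; set c := rotation k.+1.
have leC : #|'C_[set: {perm 'I_k.+1}][c]| <= k.+1.
  rewrite -[leqRHS](card_ord k.+1).
  rewrite -(card_in_imset (f := fun h : {perm 'I_k.+1} => h ord0)) ?max_card //.
  move=> g h /setIP[_ /cent1P gc] /setIP[_ /cent1P hc] /= E; apply/permP => y.
  have [i <-] := rotation_trans ord0 y.
  by rewrite -!permM -(commuteX i gc) -(commuteX i hc) !permM E.
have <- : #|[set: {perm 'I_k.+1}]| = (k.+1)`!.
  by rewrite -[RHS]card_Sn; apply: eq_card => s; rewrite !inE.
rewrite -(Lagrange (subsetIl [set: {perm 'I_k.+1}]%G 'C[c])) index_cent1.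
by rewrite leq_mul2r leC orbT.
Qed.

(** The tuples [(c, c ^+ a, 1, ..., 1)], with [c] a [k]-cycle and [a < k], are
    transitive and pairwise distinct; the second slot is where [2 <= l] enters. *)
Lemma trans_tuples_lower (l k : nat) : 2 <= l -> 0 < k -> k`! <= #|trans_tuples l 'I_k|.
Proof.
move=> Hl k_gt0; apply: leq_trans (card_class_rotation k_gt0) _.
pose f (u : {perm 'I_k} * 'I_k) : {ffun 'I_l -> {perm 'I_k}} :=
  [ffun j : 'I_l => if (j == 0 :> nat)%N then u.1 else if (j == 1 :> nat)%N then u.1 ^+ u.2 else 1].
set C := rotation k ^: _.
have l0 : 0 < l by exact: leq_trans Hl.
have f0 u : f u (Ordinal l0) = u.1 by rewrite ffunE.
have f1 u : f u (Ordinal Hl) = u.1 ^+ u.2 by rewrite ffunE.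
have powX s i x : ((rotation k ^ s) ^+ i) (s x) = s ((rotation k ^+ i) x).
  by rewrite -conjXg conjgE !permM permK.
have f_inj : {in setX C setT &, injective f}.
  move=> [c a] [d b] /setXP[/imsetP[s _ cE] _] _ E.
  have Ecd : c = d by have := f0 (c, a); rewrite E f0 /= => ->.
  congr pair => //; have := f1 (c, a); rewrite E f1 /= -Ecd cE => /permP/(_ (s (Ordinal k_gt0))).
  rewrite !powX => /perm_inj/(congr1 val); rewrite /= !rotationX !add0n !modn_small // => Eab.
  exact/val_inj/esym.
have -> : (k * #|C| = #|setX C [set: 'I_k]|)%N by rewrite cardsX cardsT card_ord mulnC.
rewrite -(card_in_imset f_inj); apply: subset_leq_card.
apply/subsetP => _ /imsetP[[c a] /setXP[/imsetP[s _ cE] _] ->].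
rewrite in_set; apply/andP; split.
  apply/comm_tuplesP => i j; rewrite !ffunE /=.
  have cc m n : c ^+ m * c ^+ n = c ^+ n * c ^+ m by rewrite -!expgD addnC.
  do ![case: ifP => _]; rewrite ?mul1g ?mulg1 // -?(cc a 1%N) -?(cc 1%N a) ?expg1 //;
    by rewrite -{1 3}(expg1 c) cc expg1.
apply/is_orbitP; split; first by apply/stableP => j x; rewrite !inE.
move=> S _ /set0Pn[x xS] /stableP stS; apply/eqP; rewrite -subTset; apply/subsetP => y _.
have [i Ei] := rotation_trans (s^-1 x) (s^-1 y).
have -> : y = (c ^+ i) (s (s^-1 x)) by rewrite cE powX Ei permKV.
rewrite permKV.
elim: i {Ei} => [|i IH]; first by rewrite perm1.
by rewrite expgSr permM; have := stS (Ordinal l0) _ IH; rewrite f0.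
Qed.

End Combinatorics.

Unset Implicit Arguments.

(** * Log-concavity for commuting tuples *)

Section Conclusion.
Local Open Scope R_scope.

Lemma INR_sum (f : nat -> nat) (n : nat) :
  INR (\sum_(k < n.+1) f k)%nat = sum_f_R0 (fun k => INR (f k)) n.
Proof.
elim: n => [|n IH]; first by rewrite big_ord_recl big_ord0 addn0.
by rewrite big_ord_recr tech5 -IH -plusE plus_INR.
Qed.

Lemma INR_fact_gt0 (n : nat) : 0 < INR n`!.
Proof. by apply: lt_0_INR; apply/ltP; exact: fact_gt0. Qed.

Lemma INR_mul (m n : nat) : INR (m * n)%nat = INR m * INR n.
Proof. by rewrite -multE mult_INR. Qed.

Lemma INR_pow (m n : nat) : INR (m ^ n)%nat = INR m ^ n.
Proof. by elim: n => [|n IH]; rewrite ?expn0 // expnS INR_mul IH. Qed.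

Lemma card_comm_tuples0 (l : nat) : #|comm_tuples l 'I_0| = 1%nat.
Proof.
have E (s t : {perm 'I_0}) : s = t by apply/permP => -[].
have -> : comm_tuples l 'I_0 = [set [ffun=> 1%g]].
  apply/setP => p; rewrite [RHS]in_set1.
  have -> : p = [ffun=> 1%g] by apply/ffunP => j; exact: E.
  by rewrite eqxx; apply/comm_tuplesP => j k; exact: E.
exact: cards1.
Qed.

Definition comm_weight (l n : nat) : R := INR #|comm_tuples l 'I_n| / INR n`!.

(** The weight [s(k)] of the recurrence.  It equals the number of subgroups of index
    [k] in [Z^l]. *)
Definition trans_weight (l k : nat) : R := INR (k * #|trans_tuples l 'I_k|)%nat / INR k`!.

Lemma comm_weight_rec (l n : nat) :
  INR n * comm_weight l n
  = sum_f_R0 (fun k => trans_weight l k * comm_weight l (n - k)%nat) n.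
Proof.
have Hn := INR_fact_gt0 n.
rewrite /comm_weight /Rdiv -Rmult_assoc -INR_mul comm_tuples_rec.
rewrite (INR_sum (fun k => 'C(n, k) * (k * #|trans_tuples l 'I_k|) * #|comm_tuples l 'I_(n - k)|)%nat).
rewrite Rmult_comm scal_sum; apply: PartSum.sum_eq => k Hk.
have Hkn : (k <= n)%nat by apply/leP.
have Hk0 := INR_fact_gt0 k; have Hnk := INR_fact_gt0 (n - k).
rewrite -(bin_fact Hkn) /trans_weight !INR_mul.
have Hb : 0 < INR 'C(n, k) by apply: lt_0_INR; apply/ltP; rewrite bin_gt0.
field; repeat split; lra.
Qed.

Lemma trans_weight_lower (l k : nat) : (2 <= l)%nat -> INR k <= trans_weight l k.
Proof.
move=> Hl; have Hk := INR_fact_gt0 k; rewrite /trans_weight.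
apply: (Rmult_le_reg_r (INR k`!)) => //.
have -> : INR (k * #|trans_tuples l 'I_k|)%nat / INR k`! * INR k`! = INR (k * #|trans_tuples l 'I_k|)%nat.
  by field; lra.
rewrite -INR_mul; apply: le_INR; apply/leP; case: k {Hk} => [|k] //.
by rewrite leq_mul2l trans_tuples_lower ?orbT.
Qed.

Lemma trans_weight_upper (l k : nat) :
  trans_weight l k <= INR (l.+1 * 2 ^ l)%nat * INR k ^ (2 * l)%nat.
Proof.
have Hk := INR_fact_gt0 k; rewrite /trans_weight.
apply: (Rmult_le_reg_r (INR k`!)) => //.
have -> : INR (k * #|trans_tuples l 'I_k|)%nat / INR k`! * INR k`! = INR (k * #|trans_tuples l 'I_k|)%nat.
  by field; lra.
rewrite -INR_pow -!INR_mul; apply: le_INR; apply/leP.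
case: k {Hk} => [|k]; first by rewrite mul0n.
apply: leq_trans (trans_tuples_upper l k.+1) _.
rewrite leq_mul2r -[leqRHS]mulnA mul2n -addnn expnD -!mulnA leq_mul2l mulnA leq_mul2r.
rewrite -expnMn; apply/orP; right; case: l => [|l'] //; rewrite leq_exp2r //; lia.
Qed.

Lemma comm_tuples_log_concave (l : nat) : (2 <= l)%nat ->
  exists n0 : nat, forall n, (n0 <= n)%nat ->
    (#|comm_tuples l 'I_n.+1| * #|comm_tuples l 'I_n.-1| * (n`! * n`!)
     <= #|comm_tuples l 'I_n| * #|comm_tuples l 'I_n| * (n.+1`! * n.-1`!))%nat.
Proof.
move=> Hl.
have w0 : comm_weight l 0 = 1 by rewrite /comm_weight card_comm_tuples0 fact0 /=; field.
have w_ge0 n : 0 <= comm_weight l n.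
  by apply: Rdiv_le_0_compat; [exact: pos_INR | exact: INR_fact_gt0].
have t0 : trans_weight l 0 = 0 by rewrite /trans_weight mul0n /=; field.
have [n0 Hn0] := eventually_log_concave _ _ _ _ t0 (fun k => trans_weight_lower l k Hl)
  (trans_weight_upper l) w0 w_ge0 (comm_weight_rec l).
exists n0 => n /Hn0; rewrite /comm_weight => H.
apply/leP; apply: INR_le; rewrite !INR_mul.
have P1 := INR_fact_gt0 n; have P2 := INR_fact_gt0 n.+1; have P3 := INR_fact_gt0 n.-1.
set a := INR #|comm_tuples l 'I_n.+1| in H *; set b := INR #|comm_tuples l 'I_n.-1| in H *.
set c := INR #|comm_tuples l 'I_n| in H *.
set f := INR n`! in H P1 *; set g := INR n.+1`! in H P2 *; set h := INR n.-1`! in H P3 *.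
have Pos : 0 < f * f * (g * h) by apply: Rmult_lt_0_compat; apply: Rmult_lt_0_compat.
have := Rmult_le_compat_r _ _ _ (Rlt_le _ _ Pos) H.
have -> : a / g * (b / h) * (f * f * (g * h)) = a * b * (f * f) by field; lra.
have -> : (c / f) ^ 2 * (f * f * (g * h)) = c * c * (g * h) by field; lra.
by rewrite /g factS INR_mul.
Qed.

End Conclusion.

Import GRing.Theory Num.Theory.

Theorem corollary1p4 (l : nat) (hl : 2 <= l) :
  exists n0 : nat, forall n : nat, n0 <= n ->
    (commuting_ratio l n.+1 * commuting_ratio l n.-1
       <= commuting_ratio l n ^+ 2)%R.
Proof.
have [n0 Hn0] := comm_tuples_log_concave l hl; exists n0 => n /Hn0 H.
have ratioE m : commuting_ratio l m = (#|comm_tuples l 'I_m|%:R / m`!%:R)%R.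
  by rewrite /commuting_ratio card_Sn.
have pos m : (0 < m`!%:R :> rat)%R by rewrite ltr0n fact_gt0.
rewrite !ratioE expr_div_n mulf_div ler_pdivrMr ?mulr_gt0 // mulrAC.
rewrite ler_pdivlMr ?exprn_gt0 // !expr2 -!natrM ler_nat.
exact: H.
Qed.
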